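(* Let $A \in \mathbb{R}^{m \times n}$, let $k$ be the target rank and $l$ the actual target rank, $1 \le k \le l < \min(m,n)$, and let $p$ be the oversampling size. Let $U_k, \Sigma_k, V_k$ be computed from $A$ by Flip-Flop SRQR with parameters $0<\varepsilon<1$ and $g>1$, and let $R_{11}, R_{12}, R_{22}, \widetilde R, g_1, g_2, \tau, \widehat\tau$ be the associated quantities (all as described in the context). (a) The following bounds hold: $$\sigma_j(\Sigma_k) \ge \frac{\sigma_j(A)}{\sqrt[4]{1 + \dfrac{2\|R_{22}\|_2^4}{\sigma_j^4(\Sigma_k)}}} \qquad (1 \le j \le k)$$ (for every $j$ with $\sigma_j(\Sigma_k)>0$), and $$\left\|A - U_k \Sigma_k V_k^T\right\|_2 \le \sigma_{k+1}(A)\, \sqrt[4]{1 + 2\left(\frac{\|R_{22}\|_2}{\sigma_{k+1}(A)}\right)^4}$$ (if $\sigma_{k+1}(A)>0$). (b) If $\widetilde R$ is nonsingular (so that $g_1,g_2,\tau,\widehat\tau$ are defined), then, using the properties of SRQR, one further has $$\sigma_j(\Sigma_k) \ge \frac{\sigma_j(A)}{\sqrt[4]{1+\min\left(2\widehat\tau^4,\ \tau^4\left(2+4\widehat\tau^4\right)\left(\dfrac{\sigma_{l+1}(A)}{\sigma_j(A)}\right)^4\right)}} \qquad (1 \le j \le k),$$ and $$\left\|A - U_k \Sigma_k V_k^T\right\|_2 \le \sigma_{k+1}(A)\, \sqrt[4]{1 + 2\tau^4\left(\frac{\sigma_{l+1}(A)}{\sigma_{k+1}(A)}\right)^4},$$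 where $\tau$ and $\widehat\tau$ satisfy $$\tau \le g_1 g_2\sqrt{(l+1)(n-l)}, \qquad \widehat\tau \le g_1 g_2 \sqrt{l(n-l)},$$ with $g_1 \le \sqrt{\frac{1+\varepsilon}{1-\varepsilon}}$ and $g_2 \le g$.
   Context: Notation: $\sigma_j(X)$ is the $j$-th largest singular value of $X$; $\|X\|_2$ is the spectral norm; $\|X\|_{1,2}$ is the largest Euclidean norm of a column of $X$; $X^{-T}=(X^{-1})^T$. Flip-Flop SRQR. Step 1: run a spectrum-revealing QR factorization (SRQR) to $l$ steps on $A$, giving $$A\Pi = QR = Q\begin{pmatrix} R_{11} & R_{12}\\ 0 & R_{22}\end{pmatrix},$$ with $\Pi\in\mathbb{R}^{n\times n}$ a permutation matrix, $Q\in\mathbb{R}^{m\times m}$ orthogonal, $R_{11}\in\mathbb{R}^{l\times l}$ upper triangular, $R_{12}\in\mathbb{R}^{l\times(n-l)}$, $R_{22}\in\mathbb{R}^{(m-l)\times(n-l)}$. Step 2: run a partial QR factorization without pivoting to $l$ steps on $R^T$: $$R^T = \begin{pmatrix} R_{11}^T & 0\\ R_{12}^T & R_{22}^T\end{pmatrix} = \widehat Q\begin{pmatrix}\widehat R_{11} & \widehat R_{12}\\ 0 & \widehat R_{22}\end{pmatrix},$$ with $\widehat Q = (\widehat Q_1\ \ \widehat Q_2)\in\mathbb{R}^{n\times n}$ orthogonal, $\widehat Q_1\in\mathbb{R}^{n\times l}$, $\widehat R_{11}\in\mathbb{R}^{l\times l}$ upper triangular, $\widehat R_{12}\in\mathbb{R}^{l\times(m-l)}$,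 $\widehat R_{22}\in\mathbb{R}^{(n-l)\times(m-l)}$. Step 3: let $\widetilde U_k\Sigma_k\widetilde V_k^T$ be the rank-$k$ truncated SVD of $A\Pi\widehat Q_1\in\mathbb{R}^{m\times l}$ (so $\Sigma_k$ is the $k\times k$ diagonal matrix of the $k$ leading singular values of $A\Pi\widehat Q_1$, and $\widetilde U_k$, $\widetilde V_k$ have the corresponding orthonormal left and right singular vectors as columns), and set $U_k=\widetilde U_k$, $V_k=\Pi\widehat Q_1\widetilde V_k$. SRQR quantities. Let $$\widetilde R=\begin{pmatrix} R_{11} & a\\ 0 & \alpha\end{pmatrix}$$ be the leading $(l+1)\times(l+1)$ submatrix of $R$ (so $a$ is the first column of $R_{12}$ and $\alpha$ the $(1,1)$ entry of $R_{22}$). When $\widetilde R$ is nonsingular define $$g_1=\frac{\|R_{22}\|_{1,2}}{|\alpha|},\qquad g_2=|\alpha|\,\big\|\widetilde R^{-T}\big\|_{1,2},$$ $$\tau = g_1g_2\,\frac{\|R_{22}\|_2}{\|R_{22}\|_{1,2}}\,\frac{\|\widetilde R^{-T}\|_{1,2}^{-1}}{\sigma_{l+1}(A)},\qquad \widehat\tau = g_1g_2\,\frac{\|R_{22}\|_2}{\|R_{22}\|_{1,2}}\,\frac{\|R_{11}^{-T}\|_{1,2}^{-1}}{\sigma_k(\Sigma_k)}.$$ Property of SRQR (known guarantee of the SRQR algorithm, to be taken as part of what it means for the factorization in Step 1 to be produced by SRQR): for the user-defined parameters $0<\varepsilon<1$ (which guides the choice of the oversampling size $p$ of the randomized column-pivoted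 QR used to initialize SRQR) and $g>1$ (the tolerance for the column swaps in SRQR), the factorization in Step 1 satisfies $g_1\le\sqrt{\frac{1+\varepsilon}{1-\varepsilon}}$ and $g_2\le g$. The oversampling size $p$ enters only through this guarantee. *)

(* Defs.v *)
From mathcomp Require Import all_boot all_order all_algebra all_fingroup.
From mathcomp Require Import polyrcf reals.

Set Implicit Arguments.
Unset Strict Implicit.
Unset Printing Implicit Defensive.

Import Order.TTheory GRing.Theory Num.Theory.
Local Open Scope ring_scope.

Definition root4 (R : rcfType) (x : R) : R := Num.sqrt (Num.sqrt x).

(* Square roots of the eigenvalues of X^T X, repeated according to algebraic
   multiplicity, in nonincreasing order ([rootsR] is increasing). The list has
   n entries, so it may end with more zeros than the min(m, n) usual ones. *)
Definition singular_values (R : rcfType) (m n : nat) (X : 'M[R]_(m, n)) :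
    seq R :=
  let p := char_poly (X^T *m X) in
  rev (flatten [seq nseq (mup x p) (Num.sqrt x) | x <- rootsR p]).

(* Numbered from 1: [sigma 1 X] is the largest singular value. The value is 0
   past the end of the list. *)
Definition sigma (R : rcfType) (m n : nat) (j : nat) (X : 'M[R]_(m, n)) : R :=
  nth 0 (singular_values X) j.-1.

Definition norm2 (R : rcfType) (m n : nat) (X : 'M[R]_(m, n)) : R := sigma 1 X.

Definition norm12 (R : rcfType) (m n : nat) (X : 'M[R]_(m, n)) : R :=
  \big[Num.max/0]_(j < n) Num.sqrt (\sum_(i < m) X i j ^+ 2).

Definition invT (R : rcfType) (n : nat) (X : 'M[R]_n) : 'M[R]_n := (invmx X)^T.

(* The casts only identify l + (m - l) with m and l + (n - l) with n. *)
Definition qr_block (R : rcfType) (m n l : nat) (hm : (l < m)%N) (hn : (l < n)%N)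
    (R11 : 'M[R]_l) (R12 : 'M[R]_(l, n - l)) (R22 : 'M[R]_(m - l, n - l)) :
    'M[R]_(m, n) :=
  castmx (subnKC (ltnW hm), subnKC (ltnW hn)) (block_mx R11 R12 0 R22).

(* QR factorization of X, without pivoting, carried out to l steps;
   [is_trig_mx] means lower triangular. *)
Record partial_qr (R : rcfType) (m n l : nat) (hm : (l < m)%N) (hn : (l < n)%N)
    (X : 'M[R]_(m, n)) := PartialQR {
  qr_Q : 'M[R]_m;
  qr_R11 : 'M[R]_l;
  qr_R12 : 'M[R]_(l, n - l);
  qr_R22 : 'M[R]_(m - l, n - l);
  qr_orthogonal : qr_Q^T *m qr_Q = 1%:M;
  qr_triangular : is_trig_mx qr_R11^T;
  qr_eq : X = qr_Q *m qr_block hm hn qr_R11 qr_R12 qr_R22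
}.

Section PartialQRTheory.
Context (R : rcfType) (m n l : nat) (hm : (l < m)%N) (hn : (l < n)%N).
Context (X : 'M[R]_(m, n)) (F : partial_qr hm hn X).

Definition qr_R : 'M[R]_(m, n) := qr_block hm hn (qr_R11 F) (qr_R12 F) (qr_R22 F).

Definition qr_Q1 : 'M[R]_(m, l) := colsub (widen_ord (ltnW hm)) (qr_Q F).

Definition qr_Rtilde : 'M[R]_l.+1 := mxsub (widen_ord hm) (widen_ord hn) qr_R.

Definition qr_alpha : R := qr_R (Ordinal hm) (Ordinal hn).

Definition qr_g1 : R := norm12 (qr_R22 F) / `|qr_alpha|.

Definition qr_g2 : R := `|qr_alpha| * norm12 (invT qr_Rtilde).

End PartialQRTheory.

(* The bounds on g1 and g2 are the guarantee that the SRQR algorithm provides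
   for its parameters eps and g; g1 and g2 are meaningful only when Rtilde is
   nonsingular. *)
Record srqr (R : rcfType) (m n l : nat) (hm : (l < m)%N) (hn : (l < n)%N)
    (eps g : R) (A : 'M[R]_(m, n)) := SRQR {
  srqr_perm : 'S_n;
  srqr_qr : partial_qr hm hn (A *m perm_mx srqr_perm);
  srqr_guarantee : qr_Rtilde srqr_qr \in unitmx ->
    qr_g1 srqr_qr <= Num.sqrt ((1 + eps) / (1 - eps)) /\ qr_g2 srqr_qr <= g
}.

(* U S V^T is a rank-k truncated SVD of X: the columns of U and V are
   orthonormal left and right singular vectors for the k leading singular
   values. *)
Definition truncated_svd (R : rcfType) (m n k : nat) (X : 'M[R]_(m, n))
    (U : 'M[R]_(m, k)) (S : 'M[R]_k) (V : 'M[R]_(n, k)) : Prop :=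
  [/\ S = diag_mx (\row_(j < k) sigma j.+1 X),
      U^T *m U = 1%:M,
      V^T *m V = 1%:M,
      X *m V = U *m S &
      X^T *m U = V *m S].

Record flip_flop_srqr (R : rcfType) (m n k l : nat) (hm : (l < m)%N)
    (hn : (l < n)%N) (eps g : R) (A : 'M[R]_(m, n)) := FlipFlopSRQR {
  ff_srqr : srqr hm hn eps g A;
  ff_qr : partial_qr hn hm (qr_R (srqr_qr ff_srqr))^T;
  ff_Utilde : 'M[R]_(m, k);
  ff_Sigma : 'M[R]_k;
  ff_Vtilde : 'M[R]_(l, k);
  ff_svd : truncated_svd (A *m perm_mx (srqr_perm ff_srqr) *m qr_Q1 ff_qr)
             ff_Utilde ff_Sigma ff_Vtilde
}.

Section FlipFlopSRQRTheory.
Context (R : rcfType) (m n k l : nat) (hm : (l < m)%N) (hn : (l < n)%N).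
Context (eps g : R) (A : 'M[R]_(m, n)) (F : flip_flop_srqr k hm hn eps g A).

Definition ff_U : 'M[R]_(m, k) := ff_Utilde F.

Definition ff_V : 'M[R]_(n, k) :=
  perm_mx (srqr_perm (ff_srqr F)) *m qr_Q1 (ff_qr F) *m ff_Vtilde F.

Definition ff_R11 : 'M[R]_l := qr_R11 (srqr_qr (ff_srqr F)).
Definition ff_R22 : 'M[R]_(m - l, n - l) := qr_R22 (srqr_qr (ff_srqr F)).
Definition ff_Rtilde : 'M[R]_l.+1 := qr_Rtilde (srqr_qr (ff_srqr F)).
Definition ff_g1 : R := qr_g1 (srqr_qr (ff_srqr F)).
Definition ff_g2 : R := qr_g2 (srqr_qr (ff_srqr F)).

Definition ff_tau : R :=
  ff_g1 * ff_g2 * (norm2 ff_R22 / norm12 ff_R22)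
  * ((norm12 (invT ff_Rtilde))^-1 / sigma l.+1 A).

Definition ff_tauhat : R :=
  ff_g1 * ff_g2 * (norm2 ff_R22 / norm12 ff_R22)
  * ((norm12 (invT ff_R11))^-1 / sigma k (ff_Sigma F)).

End FlipFlopSRQRTheory.

(* Main.v *)
Require Import Defs.
From mathcomp Require Import all_boot all_order all_algebra all_fingroup.
From mathcomp Require Import polyrcf reals.
From mathcomp Require Import complex.
From mathcomp Require Import ring lra.

(** The factorizations give an orthogonal matrix (O O') of order n, with
    O = Pi Qhat_1, and an orthogonal Q such that

      Q^T A (O O') = L = / X^T   0  \      X = Rhat_11, Y = Rhat_12,
                         \ Y^T  Z^T /      Z = Rhat_22.

    The SVD is that of A O, the first block column of L.  The second block row
    (Y^T Z^T) is R22 up to a rotation, because the second block column of R^T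
    is (0; R22^T); hence its norm is at most rho = |R22|.

    Let x = (u, v) in the rotated coordinates, with |A O u| <= b |u|.  Then

      |A x|^2 = u . (H^T L x) + v . (Z (Y^T u + Z^T v)),    H = (X^T; Y^T),

    where u . (H^T L x) <= b^2 |u|^2 + rho^2 |u| |v| and the last term is at most
    rho^2 |v| |x|.  The Cauchy-Schwarz inequality for three terms gives
    |A x|^4 <= (b^4 + 2 rho^4) |x|^4 ([block_fourth_power]).  So both estimates
    of part (a) follow from a choice of the subspace to which u is restricted.
    The subspace where A O stretches by at most sigma_j (A O) has codimension
    j - 1, and Courant-Fischer gives
      sigma_j(A)^4 <= sigma_j(Sigma_k)^4 + 2 rho^4   ([sigma_pow4_le]).
    The residual A - U_k Sigma_k V_k^T is A preceded by the projection on the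
    orthogonal complement of the columns of V_k; there u is orthogonal to the
    columns of Vtilde, A O stretches it by at most sigma_{k+1}(A O), and so
      |A - U_k Sigma_k V_k^T|^4 <= sigma_{k+1}(A)^4 + 2 rho^4
    ([residual_pow4_le]).

    For part (b), cancellation in the definitions leaves
    tau = rho / sigma_{l+1}(A), while tauhat >= rho / sigma_k(Sigma_k) because
    the rows of R11^-1 are pieces of rows of Rtilde^-1.  With these,
    2 rho^4 <= 2 tauhat^4 sigma_j(Sigma_k)^4, which is one branch of the
    minimum; the other comes from bounding sigma_j(A) / sigma_j(Sigma_k) by the
    first branch.  The bounds on tau and tauhat compare |R22| with its largest
    column, and sigma_{l+1}(A) and sigma_k(Sigma_k) with the smallest singular
    values of Rtilde and R11, hence with the largest rows of their inverses.

    Singular values are defined from the roots of a characteristic polynomial.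
    The spectral theorem for real symmetric matrices
    ([symmetric_diagonalization]) turns them into the weights of a sum of
    squares ([singular_coordinates]), from which the two halves of
    Courant-Fischer that are used here ([sigma_cut] and [sigma_le]) follow. *)

Set Implicit Arguments.
Unset Strict Implicit.
Unset Printing Implicit Defensive.

Import Order.TTheory GRing.Theory Num.Theory.
Local Open Scope ring_scope.

(** * Euclidean norms of row vectors *)

Section Euclid.
Context (R : rcfType).

Definition dot (n : nat) (u v : 'rV[R]_n) : R := (u *m v^T) 0 0.

(** Vectors are rows, because kernels of matrices are taken on the left; so a
    matrix X acts on x by [x *m X^T]. *)
Definition nsq (n : nat) (x : 'rV[R]_n) : R := dot x x.

Lemma dotE n (u v : 'rV[R]_n) : dot u v = \sum_i u 0 i * v 0 i.
Proof. by rewrite /dot mxE; apply: eq_bigr => i _; rewrite mxE. Qed.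

Lemma nsqE n (x : 'rV[R]_n) : nsq x = \sum_i x 0 i ^+ 2.
Proof. by rewrite /nsq dotE; apply: eq_bigr => i _; rewrite expr2. Qed.

Lemma nsq_ge0 n (x : 'rV[R]_n) : 0 <= nsq x.
Proof. by rewrite nsqE sumr_ge0 // => i _; apply: sqr_ge0. Qed.

Lemma nsq_eq0 n (x : 'rV[R]_n) : (nsq x == 0) = (x == 0).
Proof.
apply/idP/eqP => [|->]; last by rewrite /nsq /dot mul0mx mxE.
rewrite nsqE psumr_eq0 => [/allP h|i _]; last exact: sqr_ge0.
apply/rowP => i; rewrite mxE; apply/eqP; rewrite -sqrf_eq0.
by apply: h; rewrite mem_index_enum.
Qed.

Lemma nsq_gt0 n (x : 'rV[R]_n) : (0 < nsq x) = (x != 0).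
Proof. by rewrite lt_def nsq_ge0 nsq_eq0 andbT. Qed.

Lemma nsq0 n : nsq (0 : 'rV[R]_n) = 0.
Proof. by apply/eqP; rewrite nsq_eq0. Qed.

Lemma dotC n (u v : 'rV[R]_n) : dot u v = dot v u.
Proof. by rewrite !dotE; apply: eq_bigr => i _; rewrite mulrC. Qed.

Lemma dotDl n (u v w : 'rV[R]_n) : dot (u + v) w = dot u w + dot v w.
Proof. by rewrite /dot mulmxDl mxE. Qed.

Lemma dotDr n (u v w : 'rV[R]_n) : dot u (v + w) = dot u v + dot u w.
Proof. by rewrite dotC dotDl !(dotC u). Qed.

Lemma dotZl n a (u v : 'rV[R]_n) : dot (a *: u) v = a * dot u v.
Proof. by rewrite /dot -scalemxAl mxE. Qed.

Lemma dotZr n a (u v : 'rV[R]_n) : dot u (a *: v) = a * dot u v.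
Proof. by rewrite dotC dotZl dotC. Qed.

Lemma dot_mulmxl m n (u : 'rV[R]_m) (M : 'M_(m, n)) (v : 'rV_n) :
  dot (u *m M) v = dot u (v *m M^T).
Proof. by rewrite /dot trmx_mul trmxK mulmxA. Qed.

Lemma nsqD n (u v : 'rV[R]_n) : nsq (u + v) = nsq u + nsq v + 2 * dot u v.
Proof. by rewrite /nsq !dotDl !dotDr (dotC v u); ring. Qed.

Lemma nsqZ n a (u : 'rV[R]_n) : nsq (a *: u) = a ^+ 2 * nsq u.
Proof. by rewrite /nsq dotZl dotZr expr2 mulrA. Qed.

Lemma dot_CS n (u v : 'rV[R]_n) : dot u v ^+ 2 <= nsq u * nsq v.
Proof.
have [->|v0] := eqVneq v 0.
  by rewrite dotC -(scale0r 0) dotZl mul0r expr0n mulr_ge0 ?nsq_ge0.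
have vp : 0 < nsq v by rewrite nsq_gt0.
have := nsq_ge0 (nsq v *: u + (- dot u v) *: v).
rewrite nsqD !nsqZ dotZl dotZr.
have -> : nsq v ^+ 2 * nsq u + (- dot u v) ^+ 2 * nsq v +
  2 * (nsq v * (- dot u v * dot u v)) = nsq v * (nsq u * nsq v - dot u v ^+ 2).
  by ring.
by rewrite pmulr_rge0 // subr_ge0.
Qed.

Lemma nsq_isometry m n (M : 'M[R]_(m, n)) (x : 'rV_m) :
  M *m M^T = 1%:M -> nsq (x *m M) = nsq x.
Proof. by move=> h; rewrite /nsq dot_mulmxl -mulmxA h mulmx1. Qed.

Lemma nsq_row_mx m n (u : 'rV[R]_m) (v : 'rV[R]_n) :
  nsq (row_mx u v) = nsq u + nsq v.
Proof. by rewrite /nsq /dot tr_row_mx mul_row_col mxE. Qed.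

End Euclid.

(** * Spectral theorem for real symmetric matrices *)

Section Spectral.
Context (R : rcfType).

(** If x + i y is a complex eigenvector for a + i b, symmetry of M gives
    b (|x|^2 + |y|^2) = 0, so the eigenvalue is real and x or y is a real
    eigenvector. *)
Lemma symmetric_real_eigenvector n (M : 'M[R]_n.+1) : M^T = M ->
  exists2 v : 'rV_n.+1, v != 0 & exists a, v *m M = a *: v.
Proof.
move=> symM.
pose MC := map_mx (real_complex R) M.
have [[a b]] : exists c, root (char_poly MC) c.
  by apply/closed_rootP; rewrite size_char_poly.
rewrite -eigenvalue_root_char => /eigenvalueP[z zE z0].
pose x : 'rV[R]_n.+1 := map_mx (@complex.Re R) z.
pose y : 'rV[R]_n.+1 := map_mx (@complex.Im R) z.
have zxy i : z 0 i = Complex (x 0 i) (y 0 i).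
  by rewrite !mxE; case: (z 0 i).
have [xE yE] : x *m M = a *: x - b *: y /\ y *m M = b *: x + a *: y.
  have sumE i : (z *m MC) 0 i =
      Complex ((x *m M) 0 i) ((y *m M) 0 i).
    rewrite !mxE.
    rewrite (eq_bigr (fun j => Complex (x 0 j * M j i) (y 0 j * M j i))).
      by elim/big_rec3: _ => // j ? ? ? _ ->.
    move=> j _; have -> : MC j i = Complex (M j i) 0 by rewrite mxE.
    apply/eqP; rewrite zxy eq_complex; apply/andP.
    by rewrite /= !mulr0 subr0 add0r.
  by split; apply/rowP => i; have := sumE i; rewrite zE mxE zxy => -[] h1 h2;
     rewrite -?h1 -?h2 !mxE; ring.
have /eqP : b * (nsq x + nsq y) = 0.
  have : dot (x *m M) y = dot (y *m M) x by rewrite dot_mulmxl symM dotC.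
  rewrite xE yE !dotDl -scaleNr !dotZl (dotC y x) /nsq => h.
  by rewrite mulrDr; lra.
have xy0 : (x != 0) || (y != 0).
  rewrite -negb_and; apply: contra z0 => /andP[/eqP x0 /eqP y0].
  by apply/eqP/rowP => i; rewrite zxy x0 y0 !mxE.
rewrite mulf_eq0 paddr_eq0 ?nsq_ge0 // !nsq_eq0 => /orP[/eqP b0|]; last first.
  by move/andP => [/eqP x0 /eqP y0]; move: xy0; rewrite x0 y0 eqxx.
case/orP: xy0 => [x0|y0]; [exists x | exists y] => //; exists a.
  by rewrite xE b0 scale0r subr0.
by rewrite yE b0 scale0r add0r.
Qed.

(** The witness is the Householder reflection exchanging e and v. *)
Lemma exists_orthogonal_mapping n (e v : 'rV[R]_n) : nsq e = 1 -> nsq v = 1 ->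
  exists2 H : 'M_n, H *m H^T = 1%:M & e *m H = v.
Proof.
move=> e1 v1; have [<-|ev] := eqVneq e v.
  by exists 1%:M; rewrite ?trmx1 ?mulmx1.
have wp : 0 < nsq (e - v) by rewrite nsq_gt0 subr_eq0.
have [w wE] : exists w, w = e - v by exists (e - v).
rewrite -wE in wp.
pose H := 1%:M - (2 / nsq w) *: (w^T *m w).
have HT : H^T = H.
  by rewrite /H linearB /= trmx1 linearZ /= trmx_mul trmxK.
have ww : w *m w^T = (nsq w)%:M.
  by apply/matrixP => i j; rewrite !ord1 /nsq /dot !mxE eqxx mulr1n.
exists H.
  rewrite HT /H mulmxBl mul1mx mulmxBr mulmx1 -scalemxAl -scalemxAr.
  rewrite mulmxA -(mulmxA w^T) ww mul_mx_scalar -scalemxAl.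
  apply/matrixP => i j; rewrite !mxE; field; exact: lt0r_neq0.
rewrite /H mulmxBr mulmx1 -scalemxAr mulmxA.
have -> : e *m w^T = (nsq w / 2)%:M.
  apply/matrixP => i j; rewrite !ord1 -/(dot e w) !mxE eqxx mulr1n.
  by rewrite wE nsqD -scaleN1r nsqZ dotDr !dotZr v1 e1 -/(nsq e) e1 ?eqxx; field.
rewrite mul_scalar_mx scalerA.
have -> : 2 / nsq w * (nsq w / 2) = 1.
  by field; exact: lt0r_neq0.
by rewrite scale1r wE opprB addrC subrK.
Qed.

(** Deflation: conjugating by an orthogonal matrix whose first row is a unit
    eigenvector splits off a 1 x 1 block. *)
Theorem symmetric_diagonalization n (M : 'M[R]_n) : M^T = M ->
  exists P : 'M_n, exists2 d : 'rV_n,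
    P *m P^T = 1%:M & M = P^T *m diag_mx d *m P.
Proof.
elim: n M => [|n IHn] M symM.
  by exists 1%:M, 0; rewrite ?trmx1 ?mulmx1 //; apply/matrixP => -[].
have [v0 v0n0 [a v0M]] := symmetric_real_eigenvector symM.
pose v := (Num.sqrt (nsq v0))^-1 *: v0.
have v1 : nsq v = 1.
  rewrite nsqZ exprVn sqr_sqrtr ?nsq_ge0 // mulVf //.
  by rewrite nsq_eq0.
have vM : v *m M = a *: v by rewrite -scalemxAl v0M !scalerA mulrC.
have e1 : nsq (delta_mx 0 0 : 'rV[R]_n.+1) = 1.
  rewrite nsqE (bigD1 0) //= big1 ?addr0 => [|i /negPf i0].
    by rewrite mxE eqxx expr1n.
  by rewrite mxE i0 expr0n.
have [H HH eH] := exists_orthogonal_mapping e1 v1.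
have HtH : H^T *m H = 1%:M by exact: mulmx1C.
have [K KH] : exists K : 'M_(1 + n), K = H *m M *m H^T by eexists.
have symK : K^T = K by rewrite KH !trmx_mul trmxK symM mulmxA.
have rowK : row 0 K = a *: delta_mx 0 0.
  by rewrite rowE KH !mulmxA eH vM -scalemxAl -eH -mulmxA HH mulmx1.
have ursub0 : ursubmx K = 0.
  apply/matrixP => i j; have /rowP/(_ (rshift 1 j)) := rowK.
  rewrite !mxE ord1 /= mulr0 => <-; congr (K _ _); exact: val_inj.
have ulsubE : ulsubmx K = a%:M.
  apply/matrixP => i j; have /rowP/(_ 0) := rowK.
  rewrite !mxE !ord1 /= mulr1 mulr1n => <-; congr (K _ _); exact: val_inj.
have dlsub0 : dlsubmx K = 0.
  by rewrite -[K]symK -trmx_ursub ursub0 trmx0.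
have symD : (drsubmx K)^T = drsubmx K by rewrite trmx_drsub symK.
have [P [d PP KE]] := IHn _ symD.
pose P1 : 'M_(1 + n) := block_mx 1%:M 0 0 P.
pose d1 : 'rV_(1 + n) := row_mx a%:M d.
have P1P1 : P1 *m P1^T = 1%:M.
  rewrite /P1 tr_block_mx mulmx_block !trmx0 trmx1 !mulmx0 !mul0mx mulmx1.
  by rewrite !addr0 add0r PP -scalar_mx_block.
exists (P1 *m H : 'M_(1 + n)), d1.
  by rewrite trmx_mul mulmxA -(mulmxA P1) HH mulmx1.
have KP : K = P1^T *m diag_mx d1 *m P1.
  rewrite -[K]submxK ursub0 ulsubE dlsub0 KE /P1 /d1 diag_mx_row.
  rewrite tr_block_mx !trmx0 trmx1 !mulmx_block !mulmx0 !mul0mx !mulmx1.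
  rewrite !mul1mx !addr0 !add0r ?mul0mx; congr block_mx.
  by apply/matrixP => i j; rewrite !ord1 !mxE eqxx !mulr1n.
have -> : M = H^T *m K *m H.
  by rewrite KH !mulmxA HtH mul1mx -mulmxA HtH mulmx1.
by rewrite KP trmx_mul !mulmxA.
Qed.

End Spectral.

(** * Singular values and the Courant-Fischer inequalities *)

Section SingularValues.
Context (R : rcfType).

Lemma pairwise_flatten_nseq (T : Type) (e e' : rel T) (f : T -> nat) (g : T -> T)
    (r : seq T) :
  (forall x, e' (g x) (g x)) -> (forall x y, e x y -> e' (g x) (g y)) ->
  pairwise e r -> pairwise e' (flatten [seq nseq (f x) (g x) | x <- r]).
Proof.
move=> e'xx ee'; elim: r => [//|x r IHr] /= /andP[xr pr].
rewrite pairwise_cat IHr // andbT; apply/andP; split; last first.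
  by elim: (f x) => //= k ->; rewrite all_nseq e'xx orbT.
rewrite /allrel all_nseq; apply/orP; right.
elim: r xr {IHr pr} => //= y r IHr /andP[xy xr].
by rewrite all_cat all_nseq (ee' _ _ xy) orbT IHr.
Qed.

Lemma singular_values_sorted m n (X : 'M[R]_(m, n)) :
  sorted >=%O (singular_values X).
Proof.
rewrite /singular_values rev_sorted.
rewrite (sorted_pairwise le_trans).
apply: (@pairwise_flatten_nseq _ <%R) => // [x y /ltW|].
  exact: ler_wsqrtr.
by rewrite -(sorted_pairwise lt_trans) sorted_roots.
Qed.

Lemma singular_values_perm m n (X : 'M[R]_(m, n)) (s : seq R) :
  char_poly (X^T *m X) = \prod_(x <- s) ('X - x%:P) ->
  perm_eq (singular_values X) [seq Num.sqrt x | x <- s].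
Proof.
move=> pE; rewrite /singular_values perm_rev.
set p := char_poly _ in pE *.
have p0 : p != 0 by rewrite pE monic_neq0 // monic_prod_XsubC.
have -> : [seq nseq (mup x p) (Num.sqrt x) | x <- rootsR p] =
    [seq [seq Num.sqrt y | y <- nseq (count_mem x s) x] | x <- rootsR p].
  by apply: eq_map => x; rewrite map_nseq pE mu_prod_XsubC.
rewrite (map_comp (map Num.sqrt)) -map_flatten; apply: perm_map.
apply: perm_trans (perm_count_undup s).
apply/perm_flatten/perm_map/uniq_perm.
- exact: uniq_roots.
- exact: undup_uniq.
- move=> x; rewrite mem_undup -[RHS]root_prod_XsubC -pE.
  by have := roots_on_rootsR p0 x; rewrite inE /= => <-.
Qed.

Lemma sigma_ge0 m n j (X : 'M[R]_(m, n)) : 0 <= sigma j X.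
Proof.
rewrite /sigma; have [lt|/(nth_default 0) -> //] :=
  ltnP j.-1 (size (singular_values X)).
have : all (>= 0) (singular_values X).
  rewrite all_rev; apply/allP => y /flattenP[s /mapP[x _ ->]].
  by rewrite mem_nseq => /andP[_ /eqP ->]; apply: sqrtr_ge0.
by move/all_nthP; apply.
Qed.

Lemma sigma_anti m n i j (X : 'M[R]_(m, n)) :
  (i <= j)%N -> sigma j X <= sigma i X.
Proof.
move=> ij; have [lt|ge] := ltnP j.-1 (size (singular_values X)); last first.
  by rewrite {1}/sigma nth_default // sigma_ge0.
rewrite /sigma.
have ij1 : (i.-1 <= j.-1)%N by rewrite -!subn1 leq_sub2r.
apply: (sorted_leq_nth (leT := >=%O) _ _ 0 (singular_values_sorted X)) => //.
- by move=> x y z /= h1 h2; apply: le_trans h2 h1.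
- by move=> x; apply: lexx.
- exact: (leq_ltn_trans ij1 lt).
Qed.

Lemma sumr_diag_mx n (d : 'rV[R]_n) (y : 'rV_n) :
  dot (y *m diag_mx d) y = \sum_i d 0 i * y 0 i ^+ 2.
Proof.
by rewrite dotE; apply: eq_bigr => i _; rewrite mul_mx_diag mxE; ring.
Qed.

(** Diagonalizing X^T X identifies the roots of its characteristic polynomial
    with the weights of a sum of squares; the rows of P are eigenvectors,
    permuted to match the sorted list of singular values. *)
Theorem singular_coordinates m n (X : 'M[R]_(m, n)) :
  exists P : 'M_n, [/\ P *m P^T = 1%:M, size (singular_values X) = n &
    forall x : 'rV_n, nsq (x *m X^T) =
      \sum_(i < n) sigma i.+1 X ^+ 2 * (x *m P^T) 0 i ^+ 2].
Proof.
have symM : (X^T *m X)^T = X^T *m X by rewrite trmx_mul trmxK.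
have [P [d PP ME]] := symmetric_diagonalization symM.
have PtP : P^T *m P = 1%:M by exact: mulmx1C.
have nsqX x : nsq (x *m X^T) = \sum_i d 0 i * (x *m P^T) 0 i ^+ 2.
  by rewrite -sumr_diag_mx /nsq /dot !trmx_mul !trmxK mulmxA -(mulmxA x) ME
    !mulmxA.
have d_ge0 i : 0 <= d 0 i.
  have := nsq_ge0 (row i P *m X^T); rewrite nsqX (bigD1 i) //= big1 => [|j ji].
    by rewrite rowE -mulmxA PP mulmx1 mxE !eqxx expr1n mulr1 addr0.
  by rewrite rowE -mulmxA PP mulmx1 mxE (negPf ji) andbF expr0n mulr0.
have cpE : char_poly (X^T *m X) = \prod_(x <- [tuple d 0 i | i < n]) ('X - x%:P).
  have -> : char_poly (X^T *m X) = char_poly (diag_mx d).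
    rewrite /char_poly.
    have -> : char_poly_mx (X^T *m X) =
        map_mx polyC P^T *m char_poly_mx (diag_mx d) *m map_mx polyC P.
      rewrite /char_poly_mx mulmxBr mulmxBl -!map_mxM -ME.
      by rewrite mul_mx_scalar -scalemxAl -map_mxM PtP map_mx1 scalemx1.
    rewrite !det_mulmx mulrAC mulrC -det_mulmx -map_mxM PtP map_mx1 det1.
    by rewrite mulr1.
  rewrite char_poly_trig ?diag_mx_is_trig // big_tuple; apply: eq_bigr => i _.
  by rewrite tnth_mktuple mxE eqxx mulr1n.
have /tuple_permP[s sE] : perm_eq (singular_values X)
    [tuple Num.sqrt (d 0 i) | i < n].
  apply: perm_trans (singular_values_perm cpE) _.
  by rewrite /= -map_comp.
have sigE (i : 'I_n) : sigma i.+1 X ^+ 2 = d 0 (s i).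
  rewrite /sigma sE /= nth_mktuple tnth_mktuple sqr_sqrtr //.
exists (row_perm s P); split; last 1 first.
- move=> x; rewrite nsqX (reindex_inj (@perm_inj _ s)) /=.
  apply: eq_bigr => i _; rewrite sigE; congr (_ * _ ^+ 2).
  by rewrite !mxE; apply: eq_bigr => j _; rewrite !mxE.
- by rewrite row_permE trmx_mul mulmxA -(mulmxA (perm_mx s)) PP mulmx1
    tr_perm_mx -perm_mxM mulgV perm_mx1.
- by rewrite sE size_tuple.
Qed.

(** Courant-Fischer, upper half: outside the first j singular directions the
    map stretches by at most sigma j.+1. *)
Theorem sigma_cut m n j (X : 'M[R]_(m, n)) :
  exists C : 'M_(n, j), forall x : 'rV_n, x *m C = 0 ->
    nsq (x *m X^T) <= sigma j.+1 X ^+ 2 * nsq x.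
Proof.
have [P [PP sizeX nsqX]] := singular_coordinates X.
have PtP : P^T *m P = 1%:M by exact: mulmx1C.
(* The columns of C are the first j rows of P; the sum is the row of index b,
   or 0 when j exceeds n. *)
exists (\matrix_(a, b) \sum_(i < n | i == b :> nat) P i a) => x xC.
rewrite nsqX -(nsq_isometry (M := P^T) x) ?trmxK // nsqE mulr_sumr.
apply: ler_sum => i _; have [lt_ij|le_ji] := ltnP i j; last first.
  by rewrite ler_wpM2r ?sqr_ge0 // lerXn2r ?nnegrE ?sigma_ge0 // sigma_anti.
suff -> : (x *m P^T) 0 i = 0 by rewrite expr0n !mulr0.
have /rowP/(_ (Ordinal lt_ij)) := xC; rewrite !mxE => xCi; rewrite -[RHS]xCi.
by apply: eq_bigr => a _; rewrite !mxE (big_pred1 i).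
Qed.

Lemma exists_kernel_vector n j (C : 'M[R]_(n, j)) : (j < n)%N ->
  exists2 x : 'rV_n, x != 0 & x *m C = 0.
Proof.
move=> lt_jn; have : kermx C != 0.
  rewrite -mxrank_eq0 mxrank_ker -lt0n subn_gt0.
  exact: leq_ltn_trans (rank_leq_col C) lt_jn.
case/rowV0Pn => x /sub_kermxP xC x0; by exists x.
Qed.

(** Courant-Fischer, lower half, in the form of an upper bound for sigma: any
    constraint of codimension j leaves a nonzero vector in the span of the j + 1
    leading singular directions. *)
Theorem sigma_le m n j (X : 'M[R]_(m, n)) (C : 'M_(n, j)) (t : R) : 0 <= t ->
  (forall x : 'rV_n, x *m C = 0 -> nsq (x *m X^T) <= t ^+ 2 * nsq x) ->
  sigma j.+1 X <= t.
Proof.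
move=> t0 Ct.
have [P [PP sizeX nsqX]] := singular_coordinates X.
have [lt_jn|le_nj] := ltnP j n; last first.
  by rewrite /sigma nth_default // sizeX.
have [c c0 cPC] := exists_kernel_vector
  (rowsub (widen_ord lt_jn) P *m C) (ltnSn j).
(* x is a combination of the j + 1 leading singular directions killed by C. *)
pose x := c *m rowsub (widen_ord lt_jn) P.
have xP i : (x *m P^T) 0 i = if insub (i : nat) is Some b then c 0 b else 0.
  rewrite /x -mulmxA mul_rowsub_mx PP mxE.
  case: insubP => [b _ bi|ij].
    rewrite (bigD1 b) //= big1 ?addr0 => [|a ab].
      by rewrite !mxE -val_eqE /= bi eqxx mulr1.
    by rewrite !mxE -val_eqE /= -bi val_eqE (negPf ab) mulr0.
  rewrite big1 // => a _; rewrite !mxE -val_eqE /=.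
  by case: eqP => [ai|]; rewrite ?mulr0 //; move: ij; rewrite -ai ltn_ord.
have xC : x *m C = 0 by rewrite /x -mulmxA.
have x0 : 0 < nsq x.
  rewrite nsq_gt0; apply: contra c0 => /eqP xE0; apply/eqP/rowP => b.
  have := xP (widen_ord lt_jn b); rewrite xE0 mul0mx mxE /=.
  by rewrite valK mxE.
have : sigma j.+1 X ^+ 2 * nsq x <= t ^+ 2 * nsq x.
  apply: le_trans (Ct x xC).
  rewrite nsqX -(nsq_isometry (M := P^T) x) ?trmxK //; last exact: mulmx1C.
  rewrite nsqE mulr_sumr; apply: ler_sum => i _; rewrite xP.
  case: insubP => [b ij _|]; last by rewrite expr0n !mulr0.
  by rewrite ler_wpM2r ?sqr_ge0 // lerXn2r ?nnegrE ?sigma_ge0 // sigma_anti.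
by rewrite ler_pM2r // ler_pXn2r ?nnegrE ?sigma_ge0.
Qed.

(** The rows of W span the test space; the contraction hypothesis replaces
    orthonormality of these rows, and with 0 < t their independence follows. *)
Theorem sigma_ge m n j (X : 'M[R]_(m, n)) (W : 'M_(j.+1, n)) (t : R) :
  0 <= t ->
  (forall c : 'rV_j.+1, nsq (c *m W) <= nsq c) ->
  (forall c : 'rV_j.+1, t ^+ 2 * nsq c <= nsq (c *m W *m X^T)) ->
  t <= sigma j.+1 X.
Proof.
move=> t0 W1 Wt; have [C XC] := sigma_cut j X.
have [c c0 cWC] := exists_kernel_vector (W *m C) (ltnSn j).
have cp : 0 < nsq c by rewrite nsq_gt0.
rewrite -(@ler_pXn2r _ 2) ?nnegrE ?sigma_ge0 // -(ler_pM2r cp).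
apply: le_trans (Wt c) _; apply: le_trans (XC _ _) _; first by rewrite -mulmxA.
by rewrite ler_wpM2l ?sqr_ge0.
Qed.

Lemma sigma_last_ge m n (X : 'M[R]_(m, n)) (t : R) : 0 <= t -> (0 < n)%N ->
  (forall c : 'rV_n, t ^+ 2 * nsq c <= nsq (c *m X^T)) -> t <= sigma n X.
Proof.
case: n X => // n X t0 _ Xt; apply: (sigma_ge (W := 1%:M)) => // c.
  by rewrite mulmx1.
by rewrite mulmx1.
Qed.

Lemma nsq_norm2 m n (X : 'M[R]_(m, n)) (x : 'rV_n) :
  nsq (x *m X^T) <= norm2 X ^+ 2 * nsq x.
Proof.
have [C XC] := sigma_cut 0 X; apply: XC.
by apply/rowP => -[].
Qed.

Lemma norm2_le m n (X : 'M[R]_(m, n)) (t : R) : 0 <= t ->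
  (forall x : 'rV_n, nsq (x *m X^T) <= t ^+ 2 * nsq x) -> norm2 X <= t.
Proof. by move=> t0 Xt; apply: (@sigma_le _ _ 0 X 0). Qed.

End SingularValues.

(** * The fourth-power estimate *)

Section FourthPower.
Context (R : rcfType).

Lemma root4_ge0 (x : R) : 0 <= root4 x.
Proof. exact: sqrtr_ge0. Qed.

Lemma root4K (x : R) : 0 <= x -> root4 x ^+ 4 = x.
Proof.
by move=> x0; rewrite -[4%N]/(2 * 2)%N exprM !sqr_sqrtr ?sqrtr_ge0.
Qed.

Lemma le_mul_root4 (a s q : R) : 0 <= a -> 0 <= s -> 0 <= q ->
  a ^+ 4 <= s ^+ 4 * (1 + q) -> a <= s * root4 (1 + q).
Proof.
move=> a0 s0 q0 h; rewrite -(@ler_pXn2r _ 4) ?nnegrE ?mulr_ge0 ?root4_ge0 //.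
by rewrite exprMn root4K // addr_ge0.
Qed.

Lemma div_root4_le (a s q : R) : 0 <= a -> 0 <= s -> 0 <= q ->
  a ^+ 4 <= s ^+ 4 * (1 + q) -> a / root4 (1 + q) <= s.
Proof.
move=> a0 s0 q0 h; rewrite ler_pdivrMr ?le_mul_root4 //.
by rewrite !sqrtr_gt0 ltr_wpDr.
Qed.

Lemma le_sqrtM (p x y : R) : 0 <= x -> 0 <= y -> p ^+ 2 <= x * y ->
  p <= Num.sqrt x * Num.sqrt y.
Proof.
move=> x0 y0 h; rewrite -sqrtrM //; apply: le_trans (ler_norm _) _.
by rewrite -sqrtr_sqr ler_wsqrtr.
Qed.

Lemma CS3 (x1 x2 x3 y1 y2 y3 : R) :
  (x1 * y1 + x2 * y2 + x3 * y3) ^+ 2 <=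
  (x1 ^+ 2 + x2 ^+ 2 + x3 ^+ 2) * (y1 ^+ 2 + y2 ^+ 2 + y3 ^+ 2).
Proof.
rewrite -subr_ge0.
have -> : (x1 ^+ 2 + x2 ^+ 2 + x3 ^+ 2) * (y1 ^+ 2 + y2 ^+ 2 + y3 ^+ 2) -
  (x1 * y1 + x2 * y2 + x3 * y3) ^+ 2 = (x1 * y2 - x2 * y1) ^+ 2 +
  (x1 * y3 - x3 * y1) ^+ 2 + (x2 * y3 - x3 * y2) ^+ 2 by ring.
by rewrite !addr_ge0 ?sqr_ge0.
Qed.

(** With H = (X Y) and w = (u Y + v Z), the sum of squares on the left is
    (|u X|^2 + |u Y|^2 + uY . vZ) + vZ . w.  The constant is 2 rather than the 3
    of a term by term estimate because vZ . w is bounded as a whole, by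
    |v Z| |w|, and not split along u and v. *)
Lemma block_fourth_power l m n (X : 'M[R]_l) (Y : 'M_(l, m)) (Z : 'M_(n, m))
    (b rho : R) (u : 'rV_l) (v : 'rV_n) : 0 <= rho ->
  nsq (u *m X) + nsq (u *m Y) <= b ^+ 2 * nsq u ->
  (forall u v, nsq (u *m Y + v *m Z) <= rho ^+ 2 * (nsq u + nsq v)) ->
  (nsq (u *m X) + nsq (u *m Y + v *m Z)) ^+ 2 <=
  (b ^+ 4 + 2 * rho ^+ 4) * (nsq u + nsq v) ^+ 2.
Proof.
move=> rho0 hb hrho.
have uY : nsq (u *m Y) <= rho ^+ 2 * nsq u.
  by have := hrho u 0; rewrite mul0mx addr0 nsq0 addr0.
have vZ : nsq (v *m Z) <= rho ^+ 2 * nsq v.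
  by have := hrho 0 v; rewrite mul0mx add0r nsq0 add0r.
pose p := dot (u *m Y) (v *m Z); pose q := dot (v *m Z) (u *m Y + v *m Z).
have SE : nsq (u *m X) + nsq (u *m Y + v *m Z) =
    nsq (u *m X) + nsq (u *m Y) + p + q.
  by rewrite /q dotDr nsqD /p (dotC (v *m Z) (u *m Y)) -/(nsq (v *m Z)); ring.
pose a := Num.sqrt (nsq u); pose c := Num.sqrt (nsq v).
pose N := Num.sqrt (nsq u + nsq v).
have aE : a ^+ 2 = nsq u by rewrite sqr_sqrtr ?nsq_ge0.
have cE : c ^+ 2 = nsq v by rewrite sqr_sqrtr ?nsq_ge0.
have NE : N ^+ 2 = a ^+ 2 + c ^+ 2.
  by rewrite sqr_sqrtr ?addr_ge0 ?nsq_ge0 // aE cE.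
have leCS x y (s t : R) : 0 <= s -> 0 <= t -> nsq x <= rho ^+ 2 * s ->
    nsq y <= rho ^+ 2 * t ->
    dot (x : 'rV_m) y <= rho ^+ 2 * (Num.sqrt s * Num.sqrt t).
  move=> s0 t0 hx hy; apply: le_trans (le_sqrtM (nsq_ge0 x) (nsq_ge0 y) _) _.
    exact: dot_CS.
  have le x' s' : 0 <= s' -> nsq (x' : 'rV_m) <= rho ^+ 2 * s' ->
      Num.sqrt (nsq x') <= rho * Num.sqrt s'.
    move=> s'0 h; apply: le_trans (ler_wsqrtr h) _.
    by rewrite sqrtrM ?sqr_ge0 // sqrtr_sqr ger0_norm.
  apply: le_trans (ler_pM (sqrtr_ge0 _) (sqrtr_ge0 _) (le _ _ s0 hx) (le _ _ t0 hy)) _.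
  by rewrite [leLHS](_ : _ = rho ^+ 2 * (Num.sqrt s * Num.sqrt t)) //; ring.
have hp : p <= rho ^+ 2 * (a * c) by apply: leCS; rewrite ?nsq_ge0.
have hq : q <= rho ^+ 2 * (c * N).
  by apply: leCS; rewrite ?addr_ge0 ?nsq_ge0.
have S0 : 0 <= nsq (u *m X) + nsq (u *m Y) + p + q.
  by rewrite -SE addr_ge0 ?nsq_ge0.
have hS : nsq (u *m X) + nsq (u *m Y) + p + q <=
    b ^+ 2 * a ^+ 2 + rho ^+ 2 * (a * c) + rho ^+ 2 * (c * N).
  by rewrite !lerD // aE.
rewrite SE; apply: le_trans (_ : (b ^+ 2 * a ^+ 2 + rho ^+ 2 * (a * c) +
    rho ^+ 2 * (c * N)) ^+ 2 <= _).
  by rewrite ler_pXn2r ?nnegrE // (le_trans S0).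
apply: le_trans (CS3 _ _ _ _ _ _) _; rewrite -aE -cE.
have -> : (a ^+ 2) ^+ 2 + (a * c) ^+ 2 + (c * N) ^+ 2 =
    (a ^+ 2 + c ^+ 2) ^+ 2.
  by rewrite [(c * N) ^+ 2]exprMn NE; ring.
by rewrite le_eqVlt; apply/orP; left; apply/eqP; ring.
Qed.

Lemma pow4_sum_ge0 (b rho : R) : 0 <= b ^+ 4 + 2 * rho ^+ 4.
Proof.
by rewrite addr_ge0 ?(mulr_ge0 (ler0n _ _)) // (exprM _ 2 2) sqr_ge0.
Qed.

(** The only property of the factorization that the singular value and residual
    bounds use: if A O stretches the component x O of x by at most b, then A
    stretches x by at most the fourth root of b^4 + 2 rho^4. *)
Definition tail_controlled m n l (A : 'M[R]_(m, n)) (O : 'M_(n, l)) (rho : R) :=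
  forall (b : R) (x : 'rV_n),
    nsq (x *m O *m (A *m O)^T) <= b ^+ 2 * nsq (x *m O) ->
    nsq (x *m A^T) ^+ 2 <= (b ^+ 4 + 2 * rho ^+ 4) * nsq x ^+ 2.

Section TailControlled.
Context (m n l : nat) (A : 'M[R]_(m, n)) (O : 'M[R]_(n, l)) (rho : R).
Hypothesis Arho : tail_controlled A O rho.

Lemma tail_bound b (x : 'rV_n) :
  nsq (x *m O *m (A *m O)^T) <= b ^+ 2 * nsq (x *m O) ->
  nsq (x *m A^T) <= root4 (b ^+ 4 + 2 * rho ^+ 4) ^+ 2 * nsq x.
Proof.
move=> /Arho h.
rewrite -(@ler_pXn2r _ 2) ?nnegrE ?mulr_ge0 ?nsq_ge0 ?root4_ge0 //.
by rewrite exprMn -exprM root4K ?pow4_sum_ge0.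
Qed.

Lemma sigma_pow4_le j : (0 < j)%N ->
  sigma j A ^+ 4 <= sigma j (A *m O) ^+ 4 + 2 * rho ^+ 4.
Proof.
case: j => // j _; have [C BC] := sigma_cut j (A *m O).
have p0 := pow4_sum_ge0 (sigma j.+1 (A *m O)) rho.
rewrite -[leRHS]root4K // lerXn2r ?nnegrE ?sigma_ge0 ?root4_ge0 //.
apply: (@sigma_le _ _ _ _ _ (O *m C)) => [|x xOC]; first exact: root4_ge0.
by apply/tail_bound/BC; rewrite -mulmxA.
Qed.

Lemma sigma_isometry j : O^T *m O = 1%:M -> sigma j.+1 (A *m O) <= sigma j.+1 A.
Proof.
move=> OO; have [C AC] := sigma_cut j A.
apply: (@sigma_le _ _ _ _ _ (O^T *m C)) => [|x xOC]; first exact: sigma_ge0.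
rewrite trmx_mul mulmxA -(nsq_isometry (M := O^T) x) ?trmxK //.
by apply: AC; rewrite -mulmxA.
Qed.

End TailControlled.

(** The diagonal entries are the square roots of the eigenvalues of the Gram
    matrix, already in nonincreasing order. *)
Lemma sigma_diag_mx k (d : 'rV[R]_k) (j : 'I_k) :
  (forall i, 0 <= d 0 i) -> (forall i i' : 'I_k, (i <= i')%N -> d 0 i' <= d 0 i) ->
  sigma j.+1 (diag_mx d) = d 0 j.
Proof.
move=> d0 dmono.
have cpE : char_poly ((diag_mx d)^T *m diag_mx d) =
    \prod_(x <- [seq d 0 i ^+ 2 | i <- enum 'I_k]) ('X - x%:P).
  rewrite tr_diag_mx mulmx_diag char_poly_trig ?diag_mx_is_trig // big_map.
  rewrite big_enum; apply: eq_bigr => i _.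
  by rewrite !mxE eqxx mulr1n expr2.
have sE : singular_values (diag_mx d) = [seq d 0 i | i <- enum 'I_k].
  apply: (@sorted_eq _ >=%O).
  - by move=> x y z h1 h2; apply: le_trans h2 h1.
  - by move=> x y /andP[h1 h2]; apply: le_anti; apply/andP.
  - exact: singular_values_sorted.
  - rewrite sorted_map.
    apply: (@sub_sorted _ (relpre (@nat_of_ord k) leq)) => [i i' /= /dmono //|].
    by rewrite -sorted_map val_enum_ord iota_sorted.
  have := singular_values_perm cpE; rewrite -map_comp.
  have -> // : map (Num.sqrt \o (fun i => d 0 i ^+ 2)) (enum 'I_k) =
      [seq d 0 i | i <- enum 'I_k].
  by apply: eq_map => i /=; rewrite sqrtr_sqr ger0_norm.
by rewrite /sigma sE /= (nth_map j) ?size_enum_ord // nth_ord_enum.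
Qed.

Section TruncatedSVD.
Context (m n k : nat) (X : 'M[R]_(m, n)).
Context (U : 'M[R]_(m, k)) (S : 'M[R]_k) (V : 'M[R]_(n, k)).
Hypothesis svd : truncated_svd X U S V.

Lemma sigma_truncated j : (0 < j <= k)%N -> sigma j S = sigma j X.
Proof.
case: svd => -> _ _ _ _; case: j => // j lt_jk.
rewrite (sigma_diag_mx (Ordinal lt_jk)) ?mxE //= => [i|i i' ii'].
  by rewrite mxE sigma_ge0.
by rewrite !mxE sigma_anti.
Qed.

(** Dimension count: were x, orthogonal to V, stretched by more than
    sigma k.+1 X, the span of x and of the columns of V whose singular value
    exceeds sigma k.+1 X would be too large for [sigma_cut]. *)
Lemma truncated_svd_complement (x : 'rV_n) : x *m V = 0 ->
  nsq (x *m X^T) <= sigma k.+1 X ^+ 2 * nsq x.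
Proof.
move=> xV; rewrite leNgt; apply/negP => lt_x.
case: svd => SE UU VV XV XU.
set s := sigma k.+1 X in lt_x *.
pose P r := sigma r.+1 X <= s.
have exP : exists r, P r by exists k; apply: lexx.
(* r counts the singular values larger than sigma k.+1 X.  When some of the
   first k equal sigma k.+1 X, the span of x and of all columns of V gives no
   contradiction, so only r columns are used. *)
have [r Pr min_r] := ex_minnP exP.
have le_rk : (r <= k)%N by apply: min_r; apply: lexx.
have gt_s i : (i < r)%N -> s < sigma i.+1 X.
  by move=> lt_ir; rewrite ltNge; apply: contraL lt_ir => /min_r; rewrite -leqNgt.
pose Vr : 'M_(n, r) := colsub (widen_ord le_rk) V.
pose Ur : 'M_(m, r) := colsub (widen_ord le_rk) U.
pose dr : 'rV[R]_r := \row_i sigma i.+1 X.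
have XVr : X *m Vr = Ur *m diag_mx dr.
  rewrite /Vr mulmx_colsub XV SE; apply/matrixP => i j.
  by rewrite !mul_mx_diag !mxE.
have xX_Ur : x *m X^T *m Ur = 0.
  rewrite /Ur mulmx_colsub -mulmxA XU mulmxA xV mul0mx.
  by apply/matrixP => i j; rewrite !mxE.
have VrVr : Vr^T *m Vr = 1%:M.
  apply/matrixP => i j; have /matrixP/(_ (widen_ord le_rk i) (widen_ord le_rk j)) := VV.
  rewrite !mxE -val_eqE /= val_eqE => <-.
  by apply: eq_bigr => a _; rewrite !mxE.
have UrUr : Ur^T *m Ur = 1%:M.
  apply/matrixP => i j; have /matrixP/(_ (widen_ord le_rk i) (widen_ord le_rk j)) := UU.
  rewrite !mxE -val_eqE /= val_eqE => <-.
  by apply: eq_bigr => a _; rewrite !mxE.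
have xVr : x *m Vr = 0.
  by rewrite /Vr mulmx_colsub xV; apply/matrixP => i j; rewrite !mxE.
have [C XC] := sigma_cut r X.
have [c c0 cWC] := exists_kernel_vector (col_mx Vr^T x *m C : 'M_(r + 1, r))
  ltac:(by rewrite addn1).
pose y := c *m col_mx Vr^T x.
have yC : y *m C = 0 by rewrite /y -mulmxA.
pose c1 := lsubmx c; pose c2 := rsubmx c 0 0.
have yE : y = c1 *m Vr^T + c2 *: x.
  rewrite /y -[c in LHS]hsubmxK mul_row_col; congr (_ + _).
  by rewrite [rsubmx c in LHS]mx11_scalar mul_scalar_mx.
have nsq_y : nsq y = nsq c1 + c2 ^+ 2 * nsq x.
  rewrite yE nsqD nsqZ nsq_isometry ?trmxK // dotZr dot_mulmxl dotC trmxK.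
  by rewrite xVr /dot mul0mx mxE !mulr0 addr0.
have nsq_yX : nsq (y *m X^T) =
    \sum_(i < r) sigma i.+1 X ^+ 2 * c1 0 i ^+ 2 + c2 ^+ 2 * nsq (x *m X^T).
  have -> : y *m X^T = c1 *m diag_mx dr *m Ur^T + c2 *: (x *m X^T).
    rewrite yE mulmxDl -mulmxA -trmx_mul XVr trmx_mul tr_diag_mx !mulmxA.
    by rewrite scalemxAl.
  rewrite nsqD nsqZ nsq_isometry ?trmxK // dotZr dot_mulmxl dotC trmxK.
  rewrite xX_Ur [dot 0 _]/dot mul0mx mxE !mulr0 addr0 nsqE; congr (_ + _).
  by apply: eq_bigr => i _; rewrite mul_mx_diag !mxE exprMn mulrC.
have s0 : 0 <= s by exact: sigma_ge0.
have le_y : nsq (y *m X^T) <= s ^+ 2 * nsq y.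
  apply: le_trans (XC y yC) _; rewrite ler_wpM2r ?nsq_ge0 //.
  by rewrite lerXn2r ?nnegrE ?sigma_ge0.
have sum_le (i : 'I_r) : s ^+ 2 * c1 0 i ^+ 2 <= sigma i.+1 X ^+ 2 * c1 0 i ^+ 2.
  rewrite ler_wpM2r ?sqr_ge0 // lerXn2r ?nnegrE ?sigma_ge0 //.
  exact/ltW/gt_s.
have c2E : c2 = 0.
  apply/eqP; apply: contraTT le_y => c20.
  rewrite -ltNge nsq_y nsq_yX nsqE mulrDr mulr_sumr.
  apply: ler_ltD; first exact: ler_sum.
  by rewrite mulrCA ltr_pM2l // exprn_even_gt0.
have c1E : c1 = 0.
  move: le_y; rewrite nsq_y nsq_yX c2E expr0n !mul0r !addr0 nsqE mulr_sumr.
  rewrite -subr_le0 -sumrB => le0.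
  have ge0 (i : 'I_r) : 0 <= sigma i.+1 X ^+ 2 * c1 0 i ^+ 2 - s ^+ 2 * c1 0 i ^+ 2.
    by rewrite subr_ge0.
  have /eqP : \sum_(i < r) (sigma i.+1 X ^+ 2 * c1 0 i ^+ 2 - s ^+ 2 * c1 0 i ^+ 2) = 0.
    by apply/eqP; rewrite eq_le le0 sumr_ge0.
  rewrite psumr_eq0 // => /allP h; apply/rowP => i; rewrite [RHS]mxE.
  have := h i (mem_index_enum i); rewrite -mulrBl mulf_eq0 => /orP[|].
    rewrite subr_eq0 eqrXn2 ?sigma_ge0 // => /eqP si.
    by have := gt_s i (ltn_ord i); rewrite si ltxx.
  by rewrite sqrf_eq0 => /eqP.
case/negP: c0; rewrite -[c]hsubmxK -/c1 c1E [rsubmx c]mx11_scalar -/c2 c2E.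
by rewrite raddf0 row_mx0.
Qed.

End TruncatedSVD.

Section Residual.
Context (m n k l : nat) (A : 'M[R]_(m, n)) (O : 'M[R]_(n, l)) (rho : R).
Hypothesis OO : O^T *m O = 1%:M.
Hypothesis Arho : tail_controlled A O rho.
Context (U : 'M[R]_(m, k)) (S : 'M[R]_k) (V : 'M[R]_(l, k)).
Hypothesis svd : truncated_svd (A *m O) U S V.

(** x (A - U S (O V)^T)^T equals y A^T, where y is x minus its orthogonal
    projection on the columns of O V; so y O is orthogonal to V. *)
Lemma residual_pow4_le :
  norm2 (A - U *m S *m (O *m V)^T) ^+ 4 <= sigma k.+1 A ^+ 4 + 2 * rho ^+ 4.
Proof.
have p0 := pow4_sum_ge0 (sigma k.+1 A) rho.
rewrite -[leRHS]root4K // lerXn2r ?nnegrE ?sigma_ge0 ?root4_ge0 //.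
apply: norm2_le => [|x]; first exact: root4_ge0.
have [SE UU VV BV BU] := svd.
pose W := O *m V.
have WW : W^T *m W = 1%:M.
  by rewrite /W trmx_mul -mulmxA (mulmxA O^T) OO mul1mx.
pose z := x *m W *m W^T; pose y := x - z.
have -> : x *m (A - U *m S *m W^T)^T = y *m A^T.
  rewrite -BV -(mulmxA A) -/W -mulmxA raddfB /= mulmxBr /y mulmxBl.
  by rewrite /z /W !trmx_mul !trmxK !mulmxA.
have yW : y *m W = 0.
  by rewrite /y /z mulmxBl -(mulmxA (x *m W)) WW mulmx1 subrr.
have yx : nsq y <= nsq x.
  have yz : dot y z = 0.
    by rewrite dotC /z dot_mulmxl trmxK yW /dot trmx0 mulmx0 mxE.
  have -> : nsq x = nsq y + nsq z.
    by rewrite -[x in LHS](subrK z) nsqD -/y yz mulr0 addr0.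
  by rewrite lerDl nsq_ge0.
apply: le_trans (tail_bound (b := sigma k.+1 A) (x := y) Arho _) _; last first.
  by rewrite ler_wpM2l ?sqr_ge0.
have yOV : y *m O *m V = 0 by rewrite -mulmxA.
apply: le_trans (truncated_svd_complement svd yOV) _.
by rewrite ler_wpM2r ?nsq_ge0 // lerXn2r ?nnegrE ?sigma_ge0 // sigma_isometry.
Qed.

End Residual.
End FourthPower.

(** * The largest column norm *)

Section ColumnNorm.
Context (R : rcfType).

Lemma norm12_ge0 m n (X : 'M[R]_(m, n)) : 0 <= norm12 X.
Proof. exact: bigmax_ge_id. Qed.

Lemma nsq_col_le m n (X : 'M[R]_(m, n)) j :
  \sum_i X i j ^+ 2 <= norm12 X ^+ 2.
Proof.
have s0 : 0 <= \sum_i X i j ^+ 2 by rewrite sumr_ge0 // => i _; apply: sqr_ge0.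
rewrite -[leLHS]sqr_sqrtr // lerXn2r ?nnegrE ?norm12_ge0 ?sqrtr_ge0 //.
exact: (le_bigmax _ (fun j => Num.sqrt (\sum_i X i j ^+ 2)) j).
Qed.

Lemma entry_le_norm12 m n (X : 'M[R]_(m, n)) i j : `|X i j| <= norm12 X.
Proof.
rewrite -(@ler_pXn2r _ 2) ?nnegrE ?norm12_ge0 // real_normK ?num_real //.
apply: le_trans (nsq_col_le X j); rewrite (bigD1 i) //= lerDl.
by rewrite sumr_ge0 // => a _; apply: sqr_ge0.
Qed.

Lemma nsq_mul_norm12 m n (X : 'M[R]_(m, n)) (x : 'rV_m) :
  nsq (x *m X) <= n%:R * norm12 X ^+ 2 * nsq x.
Proof.
rewrite nsqE; apply: le_trans (_ : \sum_(j < n) norm12 X ^+ 2 * nsq x <= _).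
  apply: ler_sum => j _.
  have -> : (x *m X) 0 j = dot x (col j X)^T.
    by rewrite dotE mxE; apply: eq_bigr => i _; rewrite !mxE.
  apply: le_trans (dot_CS _ _) _; rewrite mulrC ler_wpM2r ?nsq_ge0 //.
  rewrite nsqE (eq_bigr (fun i => X i j ^+ 2)) ?nsq_col_le // => i _.
  by rewrite !mxE.
by rewrite sumr_const card_ord -mulrA mulr_natl.
Qed.

(** |y X^T|^2 = y . (y X^T X) is at most |y| sqrt(K) |y X^T|. *)
Lemma nsq_mulmx_tr m n (X : 'M[R]_(m, n)) (K : R) : 0 <= K ->
  (forall x : 'rV_m, nsq (x *m X) <= K * nsq x) ->
  forall y : 'rV_n, nsq (y *m X^T) <= K * nsq y.
Proof.
move=> K0 XK y; set s := nsq (y *m X^T).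
have : s ^+ 2 <= nsq y * (K * s).
  have sE : s = dot y (y *m X^T *m X) by rewrite /s /nsq dot_mulmxl trmxK.
  by rewrite [in leLHS]sE; apply: le_trans (dot_CS _ _) _; rewrite ler_wpM2l ?nsq_ge0 ?XK.
have [-> _|s0] := eqVneq s 0; first by rewrite mulr_ge0 ?nsq_ge0.
have sp : 0 < s by rewrite lt_def s0 nsq_ge0.
by rewrite expr2 mulrA ler_pM2r // mulrC.
Qed.

Lemma norm2_le_norm12 m n (X : 'M[R]_(m, n)) :
  norm2 X <= Num.sqrt n%:R * norm12 X.
Proof.
apply: norm2_le => [|x]; first by rewrite mulr_ge0 ?sqrtr_ge0 ?norm12_ge0.
rewrite exprMn sqr_sqrtr ?ler0n //; apply: nsq_mulmx_tr x.
  by rewrite mulr_ge0 ?ler0n ?sqr_ge0.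
exact: nsq_mul_norm12.
Qed.

Section Inverse.
Context (p : nat) (B : 'M[R]_p).
Hypothesis Bunit : B \in unitmx.

Lemma nsq_le_mulmx_tr (c : 'rV_p) :
  nsq c <= p%:R * norm12 (invT B) ^+ 2 * nsq (c *m B^T).
Proof.
have BTunit : B^T \in unitmx by rewrite unitmx_tr.
rewrite -{1}[c](mulmxK BTunit) -trmx_inv.
exact: nsq_mul_norm12.
Qed.

Lemma nsq_le_mulmx (c : 'rV_p) :
  nsq c <= p%:R * norm12 (invT B) ^+ 2 * nsq (c *m B).
Proof.
rewrite -{1}[c](mulmxK Bunit) -[invmx B]trmxK; apply: nsq_mulmx_tr.
  by rewrite mulr_ge0 ?ler0n ?sqr_ge0.
exact: nsq_mul_norm12.
Qed.

Lemma norm12_invT_gt0 : (0 < p)%N -> 0 < norm12 (invT B).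
Proof.
move=> p0; rewrite lt_def norm12_ge0 andbT; apply/eqP => N0.
have := nsq_le_mulmx (const_mx 1); rewrite N0 expr0n mulr0 mul0r leNgt nsq_gt0.
case/negP; apply/eqP => /rowP/(_ (Ordinal p0)).
by rewrite !mxE => /eqP; rewrite oner_eq0.
Qed.

End Inverse.

Lemma nsq_colsub_le m n (f : 'I_m -> 'I_n) (x : 'rV[R]_n) : injective f ->
  nsq (colsub f x) <= nsq x.
Proof.
move=> finj; rewrite !nsqE (eq_bigr (fun i => x 0 (f i) ^+ 2)) => [|i _]; last first.
  by rewrite mxE.
have <- : \sum_(j in [set f i | i in 'I_m]) x 0 j ^+ 2 = \sum_i x 0 (f i) ^+ 2.
  by rewrite big_imset //= => i i' _ _; apply: finj.
by rewrite big_mkcond /=; apply: ler_sum => j _; case: ifP; rewrite ?sqr_ge0.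
Qed.

End ColumnNorm.

(** * Block structure of the QR factors *)

Section CastBlock.
Context (R : rcfType).

Lemma nsq_castmx n n' (e : n = n') (x : 'rV[R]_n) :
  nsq (castmx (erefl, e) x) = nsq x.
Proof. by case: n' / e; rewrite castmx_id. Qed.

Lemma row_split n l (h : (l < n)%N) (x : 'rV[R]_n) : exists v,
  x = castmx (erefl, subnKC (ltnW h)) (row_mx (colsub (widen_ord (ltnW h)) x) v).
Proof.
pose x' := castmx (erefl, esym (subnKC (ltnW h))) x.
exists (rsubmx x').
have -> : colsub (widen_ord (ltnW h)) x = lsubmx x'.
  by apply/rowP => i; rewrite !mxE castmxE /= !cast_ord_id; congr (x _ _);
    apply: val_inj.
by rewrite hsubmxK /x' castmxKV.
Qed.

Lemma mul_qr_block m n l (hm : (l < m)%N) (hn : (l < n)%N) (R11 : 'M[R]_l)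
    R12 R22 (u : 'rV_l) v :
  castmx (erefl, subnKC (ltnW hm)) (row_mx u v) *m qr_block hm hn R11 R12 R22 =
  castmx (erefl, subnKC (ltnW hn)) (row_mx (u *m R11) (u *m R12 + v *m R22)).
Proof.
rewrite /qr_block; move: (subnKC (ltnW hm)) (subnKC (ltnW hn)) => {hm hn} em en.
move: (m - l)%N (n - l)%N R12 R22 v em en => m' n' R12 R22 v em en.
case: m / em; case: n / en => /=; rewrite !castmx_id mul_row_block.
by rewrite mulmx0 addr0.
Qed.

Lemma tr_qr_block m n l (hm : (l < m)%N) (hn : (l < n)%N) (R11 : 'M[R]_l)
    R12 R22 (u : 'rV_l) v :
  castmx (erefl, subnKC (ltnW hn)) (row_mx u v) *m
    (qr_block hm hn R11 R12 R22)^T =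
  castmx (erefl, subnKC (ltnW hm))
    (row_mx (u *m R11^T + v *m R12^T) (v *m R22^T)).
Proof.
rewrite /qr_block; move: (subnKC (ltnW hm)) (subnKC (ltnW hn)) => {hm hn} em en.
move: (m - l)%N (n - l)%N R12 R22 v em en => m' n' R12 R22 v em en.
case: m / em; case: n / en => /=; rewrite !castmx_id tr_block_mx mul_row_block.
by rewrite trmx0 mulmx0 add0r.
Qed.

End CastBlock.

Section PartialQR.
Context (R : rcfType) (m n l : nat) (hm : (l < m)%N) (hn : (l < n)%N).
Context (X : 'M[R]_(m, n)) (F : partial_qr hm hn X).

Let widm := widen_ord (ltnW hm).
Let widn := widen_ord (ltnW hn).

Lemma qr_Q1_orthonormal : (qr_Q1 F)^T *m qr_Q1 F = 1%:M.
Proof.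
apply/matrixP => i j; have /matrixP/(_ (widm i) (widm j)) := qr_orthogonal F.
rewrite !mxE -val_eqE /= val_eqE => <-.
by apply: eq_bigr => a _; rewrite !mxE.
Qed.

Lemma qr_R_ul i j : qr_R F (widm i) (widn j) = qr_R11 F i j.
Proof.
rewrite /qr_R castmxE.
have -> : cast_ord (esym (subnKC (ltnW hm))) (widm i) = lshift _ i by exact: val_inj.
have -> : cast_ord (esym (subnKC (ltnW hn))) (widn j) = lshift _ j by exact: val_inj.
by rewrite block_mxEul.
Qed.

Lemma qr_R_dl j : qr_R F (Ordinal hm) (widn j) = 0.
Proof.
have lm : (0 < m - l)%N by rewrite subn_gt0.
rewrite /qr_R castmxE.
have -> : cast_ord (esym (subnKC (ltnW hm))) (Ordinal hm) = rshift l (Ordinal lm).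
  by apply: val_inj; rewrite /= addn0.
have -> : cast_ord (esym (subnKC (ltnW hn))) (widn j) = lshift _ j by exact: val_inj.
by rewrite block_mxEdl mxE.
Qed.

Lemma qr_alpha_le_norm12 : `|qr_alpha F| <= norm12 (qr_R22 F).
Proof.
have lm : (0 < m - l)%N by rewrite subn_gt0.
have ln : (0 < n - l)%N by rewrite subn_gt0.
rewrite /qr_alpha /qr_R castmxE.
have -> : cast_ord (esym (subnKC (ltnW hm))) (Ordinal hm) = rshift l (Ordinal lm).
  by apply: val_inj; rewrite /= addn0.
have -> : cast_ord (esym (subnKC (ltnW hn))) (Ordinal hn) = rshift l (Ordinal ln).
  by apply: val_inj; rewrite /= addn0.
by rewrite block_mxEdr; apply: entry_le_norm12.
Qed.

Hypothesis Rt_unit : qr_Rtilde F \in unitmx.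

Let wid := widen_ord (leqnSn l).
Let M := invmx (qr_Rtilde F).

Lemma qr_Rtilde_last_row j : qr_alpha F * M ord_max j = (ord_max == j)%:R.
Proof.
have /matrixP/(_ ord_max j) := mulmxV Rt_unit; rewrite [RHS]mxE => <-.
rewrite mxE big_ord_recr /= big1 ?add0r => [|i _].
  by rewrite mxE; congr (qr_R F _ _ * _); apply: val_inj.
rewrite mxE -[RHS](mul0r (M (wid i) j)) -(qr_R_dl i).
by congr (qr_R F _ _ * M _ _); apply: val_inj.
Qed.

Lemma qr_alpha_neq0 : qr_alpha F != 0.
Proof.
apply/eqP => a0; have := qr_Rtilde_last_row ord_max.
by rewrite a0 mul0r eqxx => /eqP; rewrite eq_sym oner_eq0.
Qed.

(** The last row of Rtilde^-1 vanishes off the diagonal, so the leading blocks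
    of Rtilde and Rtilde^-1 are inverse to each other. *)
Lemma qr_R11_inverse : qr_R11 F *m mxsub wid wid M = 1%:M.
Proof.
apply/matrixP => i j; have /matrixP/(_ (wid i) (wid j)) := mulmxV Rt_unit.
rewrite mxE big_ord_recr /= [1%:M (wid i) _]mxE [1%:M i j]mxE.
rewrite -val_eqE /= val_eqE.
have -> : M ord_max (wid j) = 0.
  apply: (mulfI qr_alpha_neq0); rewrite qr_Rtilde_last_row mulr0 -val_eqE /=.
  by rewrite gtn_eqF.
rewrite mulr0 addr0 => <-; rewrite mxE; apply: eq_bigr => a _.
rewrite -qr_R_ul !mxE; congr (qr_R F _ _ * M _ _); exact: val_inj.
Qed.

Lemma qr_R11_unit : qr_R11 F \in unitmx.
Proof. by have [] := mulmx1_unit qr_R11_inverse. Qed.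

(** The columns of R11^-T are those of Rtilde^-T with the last entry removed. *)
Lemma norm12_invT_R11_le : norm12 (invT (qr_R11 F)) <= norm12 (invT (qr_Rtilde F)).
Proof.
apply/bigmax_le => [|j _]; first exact: norm12_ge0.
rewrite -[leRHS]ger0_norm ?norm12_ge0 // -sqrtr_sqr ler_wsqrtr //.
apply: le_trans (nsq_col_le _ (wid j)); rewrite big_ord_recr /=.
apply: ler_wpDr; first exact: sqr_ge0.
apply: ler_sum => i _; rewrite !mxE -/M.
have -> : invmx (qr_R11 F) = mxsub wid wid M.
  by rewrite -[LHS]mulmx1 -qr_R11_inverse mulmxA mulVmx ?qr_R11_unit ?mul1mx.
by rewrite mxE (_ : wid i = widen_ord (leqnSn l) i).
Qed.

Lemma qr_g1_ge0 : 0 <= qr_g1 F.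
Proof. by rewrite divr_ge0 ?norm12_ge0. Qed.

Lemma qr_g2_ge0 : 0 <= qr_g2 F.
Proof. by rewrite mulr_ge0 ?norm12_ge0. Qed.

Lemma norm12_R22_gt0 : 0 < norm12 (qr_R22 F).
Proof. by apply: lt_le_trans qr_alpha_le_norm12; rewrite normr_gt0 qr_alpha_neq0. Qed.

Lemma norm12_invT_Rtilde_gt0 : 0 < norm12 (invT (qr_Rtilde F)).
Proof. exact: norm12_invT_gt0. Qed.

Lemma qr_g1g2 :
  qr_g1 F * qr_g2 F = norm12 (qr_R22 F) * norm12 (invT (qr_Rtilde F)).
Proof.
by rewrite /qr_g1 /qr_g2 mulrA divfK // normr_eq0 qr_alpha_neq0.
Qed.

End PartialQR.

(** * The flip-flop factorization *)

Section FlipFlop.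
Context (R : rcfType) (m n l : nat) (hm : (l < m)%N) (hn : (l < n)%N).
Context (A : 'M[R]_(m, n)) (Pi : 'M[R]_n) (PiPi : Pi *m Pi^T = 1%:M).
Context (F1 : partial_qr hm hn (A *m Pi)) (F2 : partial_qr hn hm (qr_R F1)^T).

Let O := Pi *m qr_Q1 F2.
Let rho := norm2 (qr_R22 F1).
Let rowm u v := castmx (erefl 1%N, subnKC (ltnW hm)) (row_mx u v) : 'rV[R]_m.
Let rown u v := castmx (erefl 1%N, subnKC (ltnW hn)) (row_mx u v) : 'rV[R]_n.

Lemma flip_flop_orthonormal : O^T *m O = 1%:M.
Proof.
rewrite /O trmx_mul -mulmxA (mulmxA Pi^T) (mulmx1C PiPi) mul1mx.
exact: qr_Q1_orthonormal.
Qed.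

Lemma nsq_rowm u v : nsq (rowm u v) = nsq u + nsq v.
Proof. by rewrite nsq_castmx nsq_row_mx. Qed.

Lemma nsq_rown u v : nsq (rown u v) = nsq u + nsq v.
Proof. by rewrite nsq_castmx nsq_row_mx. Qed.

Lemma nsq_mul_tr (x : 'rV_n) : nsq (x *m A^T) = nsq (x *m Pi *m (qr_R F1)^T).
Proof.
have -> : x *m A^T = x *m Pi *m (qr_R F1)^T *m (qr_Q F1)^T.
  rewrite -mulmxA -trmx_mul -[_ *m qr_R F1](qr_eq F1) trmx_mul -mulmxA.
  by rewrite (mulmxA Pi) PiPi mul1mx.
rewrite nsq_isometry // trmxK; exact: qr_orthogonal.
Qed.

Lemma mul_qr_R_tr u v : rown u v *m (qr_Q F2)^T *m (qr_R F1)^T =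
  rowm (u *m qr_R11 F2) (u *m qr_R12 F2 + v *m qr_R22 F2).
Proof.
transitivity (rown u v *m (qr_Q F2)^T *m (qr_Q F2 *m qr_R F2)).
  by congr (_ *m _); apply: qr_eq.
by rewrite mulmxA -(mulmxA (rown u v)) (qr_orthogonal F2) mulmx1 mul_qr_block.
Qed.

(** The vectors x O and v are the coordinates of x in the orthonormal basis
    formed by the columns of Pi Qhat. *)
Lemma flip_flop_coordinates (x : 'rV_n) : exists v : 'rV_(n - l),
  nsq x = nsq (x *m O) + nsq v /\
  nsq (x *m A^T) = nsq (x *m O *m qr_R11 F2) +
    nsq (x *m O *m qr_R12 F2 + v *m qr_R22 F2).
Proof.
have QQ := mulmx1C (qr_orthogonal F2).
have [v xE] := row_split hn (x *m Pi *m qr_Q F2).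
have xO : colsub (widen_ord (ltnW hn)) (x *m Pi *m qr_Q F2) = x *m O.
  by rewrite -mulmx_colsub mulmxA.
rewrite xO -/(rown _ _) in xE; exists v; split.
  by rewrite -nsq_rown -xE !nsq_isometry.
rewrite nsq_mul_tr.
have -> : x *m Pi = rown (x *m O) v *m (qr_Q F2)^T.
  by rewrite -xE -mulmxA QQ mulmx1.
by rewrite mul_qr_R_tr nsq_rowm.
Qed.

(** The second block column of R^T is (0; R22^T), and Qhat only rotates it. *)
Lemma flip_flop_tail u v :
  nsq (u *m qr_R12 F2 + v *m qr_R22 F2) <= rho ^+ 2 * (nsq u + nsq v).
Proof.
have QQ := mulmx1C (qr_orthogonal F2).
have [q yE] := row_split hn (rown u v *m (qr_Q F2)^T).
set p := colsub _ _ in yE; rewrite -/(rown p q) in yE.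
have := mul_qr_R_tr u v; rewrite yE tr_qr_block.
move/(congr1 (castmx (esym (erefl 1%N), esym (subnKC (ltnW hm))))).
rewrite !castmxK => /eq_row_mx[_ <-].
apply: le_trans (nsq_norm2 _ _) _; rewrite ler_wpM2l ?sqr_ge0 //.
rewrite -nsq_rown -(nsq_isometry (M := (qr_Q F2)^T) (rown u v)) ?trmxK; last first.
  exact: qr_orthogonal.
by rewrite yE nsq_rown lerDr nsq_ge0.
Qed.

Lemma nsq_flip_flop (u : 'rV_l) :
  nsq (u *m (A *m O)^T) = nsq (u *m qr_R11 F2) + nsq (u *m qr_R12 F2).
Proof.
have OO := flip_flop_orthonormal.
have [v [vE AE]] := flip_flop_coordinates (u *m O^T).
have uE : u *m O^T *m O = u by rewrite -mulmxA OO mulmx1.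
have v0 : v = 0.
  apply/eqP; rewrite -nsq_eq0 -(addrI (nsq u) (esym _) : nsq v = 0) //.
  by rewrite -{2}uE -vE nsq_isometry ?trmxK ?addr0.
by rewrite trmx_mul mulmxA AE uE v0 mul0mx addr0.
Qed.

Theorem flip_flop_tail_controlled : tail_controlled A O rho.
Proof.
move=> b x; rewrite nsq_flip_flop; have [v [-> ->]] := flip_flop_coordinates x.
move=> hb; apply: block_fourth_power hb flip_flop_tail.
exact: sigma_ge0.
Qed.

(** With R^T = Qhat T and T block upper triangular, comparing the leading block
    columns gives Rhat11^T Rhat11 = R11 R11^T + R12 R12^T. *)
Lemma nsq_R11_le (y : 'rV_l) : nsq (y *m qr_R11 F1) <= nsq (y *m (qr_R11 F2)^T).
Proof.
have QQ := qr_orthogonal F2.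
have RE : qr_R F1 = (qr_R F2)^T *m (qr_Q F2)^T.
  by rewrite -trmx_mul -[RHS](congr1 trmx (qr_eq F2)) trmxK.
have yR : nsq (rowm y 0 *m qr_R F1) = nsq (y *m qr_R11 F1) + nsq (y *m qr_R12 F1).
  by rewrite /qr_R /rowm mul_qr_block mul0mx addr0 nsq_rown.
have yRE : rowm y 0 *m qr_R F1 = rowm y 0 *m (qr_R F2)^T *m (qr_Q F2)^T.
  by rewrite -mulmxA; congr (_ *m _).
have : nsq (rowm y 0 *m qr_R F1) = nsq (y *m (qr_R11 F2)^T).
  rewrite yRE nsq_isometry ?trmxK // tr_qr_block !mul0mx addr0 nsq_castmx.
  by rewrite nsq_row_mx nsq0 addr0.
by rewrite yR => <-; rewrite lerDl nsq_ge0.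
Qed.

(** R11 bounds Rhat11^T from below by [nsq_R11_le], and a square matrix and its
    transpose have the same least stretch. *)
Lemma nsq_le_flip_flop (u : 'rV_l) : qr_R11 F1 \in unitmx ->
  nsq u <= l%:R * norm12 (invT (qr_R11 F1)) ^+ 2 * nsq (u *m (A *m O)^T).
Proof.
move=> R11_unit; set K := l%:R * _.
have K0 : 0 <= K by rewrite mulr_ge0 ?ler0n ?sqr_ge0.
have le_tr (y : 'rV_l) : nsq y <= K * nsq (y *m (qr_R11 F2)^T).
  apply: le_trans (nsq_le_mulmx R11_unit y) _.
  by rewrite ler_wpM2l ?nsq_R11_le.
have Rh_unit : qr_R11 F2 \in unitmx.
  rewrite -unitmx_tr -row_free_unit -kermx_eq0; apply/rowV0P => y /sub_kermxP yR.
  apply/eqP; rewrite -nsq_eq0 eq_le nsq_ge0 andbT.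
  by apply: le_trans (le_tr y) _; rewrite yR nsq0 mulr0.
apply: le_trans (_ : K * nsq (u *m qr_R11 F2) <= _); last first.
  by rewrite ler_wpM2l // nsq_flip_flop lerDl nsq_ge0.
rewrite -{1}[u](mulmxK Rh_unit) -[invmx _]trmxK; apply: nsq_mulmx_tr => // y.
have RhT_unit : (qr_R11 F2)^T \in unitmx by rewrite unitmx_tr.
by rewrite -{2}[y](mulmxKV RhT_unit) trmx_inv; apply: le_tr.
Qed.

Lemma sigma_flip_flop_ge : (0 < l)%N -> qr_R11 F1 \in unitmx ->
  (norm12 (invT (qr_R11 F1)))^-1 <= Num.sqrt l%:R * sigma l (A *m O).
Proof.
move=> l0 R11_unit; have N0 := norm12_invT_gt0 R11_unit l0.
have sl : 0 < Num.sqrt (l%:R : R) by rewrite sqrtr_gt0 ltr0n.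
rewrite mulrC -ler_pdivrMr //; set N := norm12 _ in N0 *.
apply: sigma_last_ge => // [|c]; first by rewrite divr_ge0 ?invr_ge0 ?ltW.
rewrite expr_div_n exprVn sqr_sqrtr ?ler0n // mulrC -invfM.
rewrite ler_pdivrMr ?mulr_gt0 ?exprn_gt0 ?ltr0n //.
rewrite [leRHS]mulrC [N ^+ 2 * _]mulrC.
exact: nsq_le_flip_flop.
Qed.

(** Test space: the first l + 1 coordinates after the column permutation; on it
    R restricts to Rtilde up to discarded rows. *)
Lemma sigma_succ_ge : qr_Rtilde F1 \in unitmx ->
  (norm12 (invT (qr_Rtilde F1)))^-1 <= Num.sqrt l.+1%:R * sigma l.+1 A.
Proof.
move=> Rt_unit; have N0 := norm12_invT_Rtilde_gt0 Rt_unit.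
set N := norm12 _ in N0 *.
have sl : 0 < Num.sqrt (l.+1%:R : R) by rewrite sqrtr_gt0 ltr0n.
rewrite mulrC -ler_pdivrMr //.
pose E : 'M[R]_(l.+1, n) := rowsub (widen_ord hn) 1%:M.
apply: (@sigma_ge _ _ _ _ _ (E *m Pi^T)) => [|c|c].
- by rewrite divr_ge0 ?invr_ge0 ?ltW.
- rewrite mulmxA nsq_isometry ?trmxK ?(mulmx1C PiPi) //.
  rewrite nsq_isometry // /E; apply/matrixP => i j.
  rewrite mxE (bigD1 (widen_ord hn i)) //= big1 ?addr0 => [|a ai].
    by rewrite !mxE eqxx mul1r -val_eqE /= val_eqE eq_sym.
  by rewrite !mxE eq_sym (negPf ai) mul0r.
rewrite nsq_mul_tr mulmxA -(mulmxA _ Pi^T) (mulmx1C PiPi) mulmx1.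
apply: le_trans (_ : nsq (c *m (qr_Rtilde F1)^T) <= _).
  rewrite expr_div_n exprVn sqr_sqrtr ?ler0n // mulrC -invfM.
  rewrite ler_pdivrMr ?mulr_gt0 ?exprn_gt0 ?ltr0n //.
rewrite [leRHS]mulrC [N ^+ 2 * _]mulrC.
  exact: nsq_le_mulmx_tr.
have -> : c *m (qr_Rtilde F1)^T =
    colsub (widen_ord hm) (c *m E *m (qr_R F1)^T).
  rewrite -mulmxA -mulmx_colsub /E mul_rowsub_mx mul1mx; congr (_ *m _).
  by apply/matrixP => i j; rewrite !mxE.
by apply: nsq_colsub_le => i j /(congr1 val) /= ij; apply: val_inj.
Qed.

End FlipFlop.

(** * Bounds for Flip-Flop SRQR *)

Section SRQRQuantities.
Context (R : rcfType) (m n k l : nat) (hm : (l < m)%N) (hn : (l < n)%N).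
Context (eps g : R) (A : 'M[R]_(m, n)) (F : flip_flop_srqr k hm hn eps g A).

Let Pi : 'M[R]_n := perm_mx (srqr_perm (ff_srqr F)).
Let O := Pi *m qr_Q1 (ff_qr F).
Let rho := norm2 (ff_R22 F).

Lemma perm_mx_orthonormal : Pi *m Pi^T = 1%:M.
Proof. by rewrite tr_perm_mx -perm_mxM mulgV perm_mx1. Qed.

Lemma ff_truncated_svd : truncated_svd (A *m O) (ff_U F) (ff_Sigma F) (ff_Vtilde F).
Proof. by rewrite /O mulmxA; apply: ff_svd. Qed.

Lemma ff_tail_controlled : tail_controlled A O rho.
Proof. exact: (flip_flop_tail_controlled perm_mx_orthonormal).
Qed.

Lemma ff_sigma_pow4_le j : (0 < j <= k)%N ->
  sigma j A ^+ 4 <= sigma j (ff_Sigma F) ^+ 4 + 2 * rho ^+ 4.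
Proof.
move=> /[dup] /andP[j0 _] jk; rewrite (sigma_truncated ff_truncated_svd jk).
exact: sigma_pow4_le ff_tail_controlled _ j0.
Qed.

Lemma ff_residual_pow4_le :
  norm2 (A - ff_U F *m ff_Sigma F *m (ff_V F)^T) ^+ 4 <=
  sigma k.+1 A ^+ 4 + 2 * rho ^+ 4.
Proof.
apply: residual_pow4_le ff_truncated_svd.
  exact: (flip_flop_orthonormal perm_mx_orthonormal (ff_qr F)).
exact: ff_tail_controlled.
Qed.

Hypothesis Rt_unit : ff_Rtilde F \in unitmx.

Lemma sigma_succ_gt0 : 0 < sigma l.+1 A.
Proof.
have := sigma_succ_ge perm_mx_orthonormal Rt_unit.
have : 0 < (norm12 (invT (ff_Rtilde F)))^-1.
  by rewrite invr_gt0 norm12_invT_Rtilde_gt0.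
move=> /lt_le_trans h /h; rewrite pmulr_rgt0 // sqrtr_gt0 ltr0n //.
Qed.

Lemma sigma_k_ge : (0 < k)%N -> (k <= l)%N ->
  (norm12 (invT (ff_R11 F)))^-1 <= Num.sqrt l%:R * sigma k (ff_Sigma F).
Proof.
move=> k0 kl; have l0 := leq_trans k0 kl.
have R11_unit := qr_R11_unit Rt_unit.
apply: le_trans (sigma_flip_flop_ge perm_mx_orthonormal (ff_qr F) l0 R11_unit) _.
rewrite ler_wpM2l ?sqrtr_ge0 //.
by rewrite (sigma_truncated ff_truncated_svd) ?k0 ?leqnn // sigma_anti.
Qed.

Lemma sigma_k_gt0 : (0 < k)%N -> (k <= l)%N -> 0 < sigma k (ff_Sigma F).
Proof.
move=> k0 kl; have l0 := leq_trans k0 kl; have := sigma_k_ge k0 kl.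
have : 0 < (norm12 (invT (ff_R11 F)))^-1.
  by rewrite invr_gt0 norm12_invT_gt0 // qr_R11_unit.
by move=> /lt_le_trans h /h; rewrite pmulr_rgt0 // sqrtr_gt0 ltr0n.
Qed.

Lemma ff_tauE : ff_tau F = rho / sigma l.+1 A.
Proof.
rewrite /ff_tau /ff_g1 /ff_g2 qr_g1g2 // -/(ff_R22 F) -/(ff_Rtilde F) -/rho.
have N22 : norm12 (ff_R22 F) != 0 by rewrite lt0r_neq0 ?norm12_R22_gt0.
have Nt : norm12 (invT (ff_Rtilde F)) != 0.
  by rewrite lt0r_neq0 ?norm12_invT_Rtilde_gt0.
by field; rewrite N22 Nt lt0r_neq0 ?sigma_succ_gt0.
Qed.

(** In tauhat the factors g1 and g2 leave the quotient of the largest columns of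
    Rtilde^-T and R11^-T, which is at least 1. *)
Lemma ff_tauhat_ge : (0 < k)%N -> (k <= l)%N ->
  rho <= ff_tauhat F * sigma k (ff_Sigma F).
Proof.
move=> k0 kl; have l0 := leq_trans k0 kl; have sk := sigma_k_gt0 k0 kl.
have N11 : 0 < norm12 (invT (ff_R11 F)) by rewrite norm12_invT_gt0 ?qr_R11_unit.
rewrite /ff_tauhat /ff_g1 /ff_g2 qr_g1g2 // -/(ff_R22 F) -/(ff_Rtilde F) -/rho.
have N22 : norm12 (ff_R22 F) != 0 by rewrite lt0r_neq0 ?norm12_R22_gt0.
have -> : norm12 (ff_R22 F) * norm12 (invT (ff_Rtilde F)) *
    (rho / norm12 (ff_R22 F)) *
    ((norm12 (invT (ff_R11 F)))^-1 / sigma k (ff_Sigma F)) *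
    sigma k (ff_Sigma F) =
    rho * (norm12 (invT (ff_Rtilde F)) / norm12 (invT (ff_R11 F))).
  by field; rewrite N22 !lt0r_neq0.
rewrite ler_peMr ?sigma_ge0 // ler_pdivlMr // mul1r.
exact: norm12_invT_R11_le.
Qed.

(** Stated for p and N so as to serve tau (p = l + 1 and Rtilde) and tauhat
    (p = l and R11) alike. *)
Lemma g1g2_ratio_le (p : nat) (N s : R) : 0 <= N -> 0 < s ->
  N^-1 <= Num.sqrt p%:R * s ->
  ff_g1 F * ff_g2 F * (rho / norm12 (ff_R22 F)) * (N^-1 / s) <=
  ff_g1 F * ff_g2 F * Num.sqrt (p * (n - l))%:R.
Proof.
move=> N0 s0 Ns.
rewrite -mulrA ler_wpM2l ?(mulr_ge0 (qr_g1_ge0 _) (qr_g2_ge0 _)) //.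
have N22 : 0 < norm12 (ff_R22 F) by apply: norm12_R22_gt0.
rewrite mulnC natrM sqrtrM ?ler0n // ler_pM //.
- by rewrite divr_ge0 ?sigma_ge0 ?norm12_ge0.
- by rewrite divr_ge0 ?invr_ge0 // ltW.
- by rewrite ler_pdivrMr // norm2_le_norm12.
- by rewrite ler_pdivrMr.
Qed.

End SRQRQuantities.

Theorem theorem3p1 (R : realType) (m n k l : nat)
    (hk : (1 <= k)%N) (hkl : (k <= l)%N) (hm : (l < m)%N) (hn : (l < n)%N)
    (eps g : R) (heps0 : 0 < eps) (heps1 : eps < 1) (hg : 1 < g)
    (A : 'M[R]_(m, n)) (F : flip_flop_srqr k hm hn eps g A) :
  let U := ff_U F in
  let S := ff_Sigma F in
  let V := ff_V F in
  let R22 := ff_R22 F in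
  let g1 := ff_g1 F in
  let g2 := ff_g2 F in
  let tau := ff_tau F in
  let tauhat := ff_tauhat F in
  ((forall j : nat, (1 <= j <= k)%N -> 0 < sigma j S ->
      sigma j A / root4 (1 + 2 * norm2 R22 ^+ 4 / sigma j S ^+ 4)
        <= sigma j S)
   /\ (0 < sigma k.+1 A ->
        norm2 (A - U *m S *m V^T)
          <= sigma k.+1 A
             * root4 (1 + 2 * (norm2 R22 / sigma k.+1 A) ^+ 4)))
  /\ (ff_Rtilde F \in unitmx ->
      [/\ forall j : nat, (1 <= j <= k)%N ->
            sigma j A
              / root4 (1 + Num.min (2 * tauhat ^+ 4)
                             (tau ^+ 4 * (2 + 4 * tauhat ^+ 4)
                              * (sigma l.+1 A / sigma j A) ^+ 4))
              <= sigma j S,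
          norm2 (A - U *m S *m V^T)
            <= sigma k.+1 A
               * root4 (1 + 2 * tau ^+ 4 * (sigma l.+1 A / sigma k.+1 A) ^+ 4),
          tau <= g1 * g2 * Num.sqrt ((l.+1 * (n - l))%:R)
            /\ tauhat <= g1 * g2 * Num.sqrt ((l * (n - l))%:R) &
          g1 <= Num.sqrt ((1 + eps) / (1 - eps)) /\ g2 <= g]).
Proof.
move=> U S V R22 g1 g2 tau tauhat.
have a2 := ff_residual_pow4_le F; rewrite -/U -/S -/V -/R22 in a2.
set rho := norm2 R22 in a2 *.
have a1 j : (1 <= j <= k)%N -> sigma j A ^+ 4 <= sigma j S ^+ 4 + 2 * rho ^+ 4.
  exact: ff_sigma_pow4_le.
have rho0 : 0 <= rho by exact: sigma_ge0.
have pow0 (x : R) : 0 <= x ^+ 4 by rewrite (exprM _ 2 2) sqr_ge0.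
split; [split|].
- move=> j jk sj; apply: div_root4_le; rewrite ?sigma_ge0 //.
    by rewrite divr_ge0 // mulr_ge0 // ler0n.
  apply: le_trans (a1 _ jk) _; rewrite mulrDr mulr1 [_ ^+ 4 * (_ / _)]mulrC.
  by rewrite divfK // expf_neq0 ?lt0r_neq0.
- move=> sk; apply: le_mul_root4; rewrite ?sigma_ge0 ?(mulr_ge0 (ler0n _ 2)) //.
  apply: le_trans a2 _; rewrite le_eqVlt; apply/orP; left; apply/eqP.
  by field; rewrite lt0r_neq0.
move=> Rt_unit.
have sl : 0 < sigma l.+1 A by exact: sigma_succ_gt0 Rt_unit.
have tauE : tau = rho / sigma l.+1 A by exact: ff_tauE.
have sk : 0 < sigma k S by exact: sigma_k_gt0.
have rho_le : rho <= tauhat * sigma k S by exact: ff_tauhat_ge.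
have rhoE : rho = tau * sigma l.+1 A by rewrite tauE divfK ?lt0r_neq0.
split.
- move=> j jk; have /andP[j1 le_jk] := jk.
  have sjk : sigma k S <= sigma j S by exact: sigma_anti.
  have sj : 0 < sigma j S by exact: lt_le_trans sjk.
  have sA : 0 < sigma j A.
    by apply: lt_le_trans sl _; rewrite sigma_anti // ltnW // ltnS (leq_trans le_jk).
  have th0 : 0 <= tauhat by rewrite -(pmulr_lge0 _ sk) (le_trans rho0).
  have rho4 : rho ^+ 4 <= tauhat ^+ 4 * sigma j S ^+ 4.
    rewrite -exprMn lerXn2r ?nnegrE ?(mulr_ge0 th0) ?sigma_ge0 //.
    by apply: le_trans rho_le _; rewrite ler_wpM2l.
  (* q1 and q2 are the two branches of the minimum. *)
  have q1 : sigma j A ^+ 4 <= sigma j S ^+ 4 * (1 + 2 * tauhat ^+ 4).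
    apply: le_trans (a1 _ jk) _; nra.
  have q2 : sigma j A ^+ 4 <= sigma j S ^+ 4 *
      (1 + tau ^+ 4 * (2 + 4 * tauhat ^+ 4) * (sigma l.+1 A / sigma j A) ^+ 4).
    apply: le_trans (a1 _ jk) _; rewrite mulrDr mulr1 lerD2l.
    (* The factor in parentheses on the right is at least 1 by q1. *)
    have -> : sigma j S ^+ 4 * (tau ^+ 4 * (2 + 4 * tauhat ^+ 4) *
        (sigma l.+1 A / sigma j A) ^+ 4) = 2 * rho ^+ 4 *
        (sigma j S ^+ 4 * (1 + 2 * tauhat ^+ 4) / sigma j A ^+ 4).
      by rewrite rhoE; field; rewrite lt0r_neq0.
    by rewrite ler_peMr ?mulr_ge0 ?ler0n // ler_pdivlMr ?exprn_gt0 // mul1r.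
  apply: div_root4_le; rewrite ?sigma_ge0 //.
    have th4 c : 0 <= c%:R * tauhat ^+ 4 by exact: mulr_ge0 (ler0n _ c) (pow0 _).
    have c0 : 0 <= 2 + 4 * tauhat ^+ 4 by exact: addr_ge0 (ler0n _ 2) (th4 4%N).
    rewrite le_min th4; exact: mulr_ge0 (mulr_ge0 (pow0 _) c0) (pow0 _).
  by rewrite minEle; case: ifP.
- have sk1 : 0 < sigma k.+1 A by apply: lt_le_trans sl _; rewrite sigma_anti.
  apply: le_mul_root4; rewrite ?sigma_ge0 //.
    exact: mulr_ge0 (mulr_ge0 (ler0n _ 2) (pow0 _)) (pow0 _).
  apply: le_trans a2 _; rewrite le_eqVlt; apply/orP; left; apply/eqP.
  by rewrite rhoE; field; rewrite lt0r_neq0.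
- split; apply: g1g2_ratio_le; rewrite ?norm12_ge0 //.
    exact: (sigma_succ_ge (perm_mx_orthonormal F) Rt_unit).
  exact: sigma_k_ge.
- exact: srqr_guarantee.
Qed.
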